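(* For any Lebesgue measurable set $I\subset\mathbb{R}^n$ with $|I|<\infty$, one has $$\|[H,P_I]\|=\|[H,Q_I]\|\ge \pi/2 .$$
   Context: $\hat f(\xi)=\int_{\mathbb{R}^n} f(x)e^{-2\pi i x\cdot\xi}dx$ is the Fourier-Plancherel transform, regarded as a unitary operator $U_{\mathcal F}$ on $L^2(\mathbb{R}^n)$; it satisfies $U_{\mathcal F}^4=1$. $P_I$ is the orthogonal projection $P_If=\chi_If$ on $L^2(\mathbb{R}^n)$, where $\chi_I$ is the characteristic function of $I$, and $Q_I=U_{\mathcal F}^*P_IU_{\mathcal F}$. Let $E_1,E_{-1},E_i,E_{-i}$ be the eigenprojections of $U_{\mathcal F}$ for the eigenvalues $1,-1,i,-i$. $H$ denotes the selfadjoint natural logarithm of the Fourier transform, $e^{iH}=U_{\mathcal F}$, given by $H=-\pi E_{-1}+\frac{\pi}{2}E_i-\frac{\pi}{2}E_{-i}$. $[A,B]=AB-BA$, $|I|$ is the Lebesgue measure of $I$ and $\|\cdot\|$ is the operator norm.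
   Formalization: The lower bound π/2 is stated only for |I| > 0 (if |I| = 0 then P_I = Q_I = 0 and both commutators vanish, so the bound fails), and n ≥ 1 is assumed (for n = 0 the Fourier transform is the identity and H = 0); the equality of norms is kept for all I with |I| < ∞. *)

(* Defs.v *)
From HB Require Import structures.
From mathcomp Require Import all_boot all_order all_algebra.
From mathcomp Require Import all_classical all_reals all_analysis.
From mathcomp Require Import measurable_realfun.
From mathcomp.real_closed Require Import complex.
From mathcomp Require Import ring.

Set Implicit Arguments.
Unset Strict Implicit.
Unset Printing Implicit Defensive.

Import Order.TTheory GRing.Theory Num.Theory.
Import numFieldNormedType.Exports.

Local Open Scope classical_set_scope.
Local Open Scope ring_scope.

Section tuple_measure.
Context d (T : measurableType d) (R : realType) (n : nat).
Variables (m1 : {sigma_finite_measure set T -> \bar R})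
          (m2 : {sigma_finite_measure set (n.-tuple T) -> \bar R}).

Let consp (p : T * n.-tuple T) : n.+1.-tuple T := [tuple of p.1 :: p.2].

Let mconsp : measurable_fun setT consp.
Proof. exact: measurable_cons. Qed.

(* the product measure, carried over to T^(n+1) by (x, t) |-> x :: t *)
Definition cons_measure : set (n.+1.-tuple T) -> \bar R :=
  pushforward (m1 \x m2)%E consp.

Let cons_measure0 : cons_measure set0 = 0%E.
Proof. by rewrite /cons_measure /pushforward preimage_set0 measure0. Qed.

Let cons_measure_ge0 A : (0 <= cons_measure A)%E.
Proof. exact: measure_ge0. Qed.

Let cons_measure_sigma_additive : semi_sigma_additive cons_measure.
Proof.
exact: (@measure_semi_sigma_additive _ _ _
  (measure_function_pushforward__canonical__measure_function_Measure
    (m1 \x m2)%E mconsp)).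
Qed.

HB.instance Definition _ := isMeasure.Build _ _ _ cons_measure
  cons_measure0 cons_measure_ge0 cons_measure_sigma_additive.

Let cons_measure_sigma_finite : sigma_finite setT cons_measure.
Proof.
have /sigma_finiteP[F [TF ndF Foo]] := sigma_finiteT m1.
have /sigma_finiteP[G [TG ndG Goo]] := sigma_finiteT m2.
pose uncons (t : n.+1.-tuple T) : (T * n.-tuple T)%type :=
  (thead t, [tuple of behead t]).
have consK : cancel consp uncons.
  move=> [x t]; rewrite /uncons /consp/= theadE; congr (_, _).
  exact/val_inj.
have muncons : measurable_fun setT uncons.
  apply/measurable_fun_pairP; split.
    exact: (@measurable_tnth _ _ _ ord0).
  exact: measurable_behead.
exists (fun k => uncons @^-1` (F k `*` G k)).
  apply/seteqP; split=> // t _.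
  have [k _ Fk] : (\bigcup_k F k) (thead t) by rewrite -TF.
  have [l _ Gl] : (\bigcup_k G k) [tuple of behead t] by rewrite -TG.
  exists (maxn k l) => //; split => /=.
  - by move: Fk; exact/subsetPset/ndF/leq_maxl.
  - by move: Gl; exact/subsetPset/ndG/leq_maxr.
move=> k; have [mF Fk] := Foo k; have [mG Gk] := Goo k; split.
  rewrite -[X in measurable X]setTI; apply: muncons => //.
  exact: measurableX.
rewrite /cons_measure /pushforward.
rewrite -[_ @^-1` _]/((uncons \o consp) @^-1` (F k `*` G k)).
rewrite (_ : uncons \o consp = id) ?preimage_id; last first.
  by apply/funext => p; exact: consK.
by rewrite product_measure1E// lte_mul_pinfty// ge0_fin_numE.
Qed.

HB.instance Definition _ := Measure_isSigmaFinite.Build _ _ _ cons_measure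
  cons_measure_sigma_finite.

End tuple_measure.

(* n-fold product of the Lebesgue measure, on the Borel subsets of R^n *)
Fixpoint borel_lebesgue (R : realType) (n : nat) :
    {sigma_finite_measure set (n.-tuple (measurableTypeR R)) -> \bar R} :=
  match n with
  | 0 => \d_([tuple] : 0.-tuple (measurableTypeR R))
  | n'.+1 => cons_measure (@lebesgue_measure R) (borel_lebesgue R n')
  end.

(* n-tuples with the Lebesgue sigma-algebra: [measurable I] for [I : set (Rn R n)]
   means that I is Caratheodory measurable for the Lebesgue outer measure *)
Definition Rn (R : realType) (n : nat) :=
  caratheodory_type (borel_lebesgue R n)^*%mu.

HB.instance Definition _ (R : realType) (n : nat) := Measurable.on (Rn R n).

Definition lebesgue_Rn (R : realType) (n : nat) : set (Rn R n) -> \bar R :=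
  @completed_measure_extension _ _ _ (borel_lebesgue R n).

HB.instance Definition _ (R : realType) (n : nat) :=
  Measure.on (@lebesgue_Rn R n).

Section L2.
Context d (T : measurableType d) (R : realType).
Variable mu : {measure set T -> \bar R}.

Let C := R[i].

Definition cmeasurable (f : T -> C) : Prop :=
  measurable_fun setT (fun x => complex.Re (f x)) /\
  measurable_fun setT (fun x => complex.Im (f x)).

Definition abs2 (z : C) : R := complex.Re z ^+ 2 + complex.Im z ^+ 2.

Definition square_integrable : {pred T -> C} :=
  mem [set f | cmeasurable f /\ (\int[mu]_x (abs2 (f x))%:E < +oo)%E].

Lemma abs2_ge0 (z : C) : 0 <= abs2 z.
Proof. by rewrite addr_ge0// sqr_ge0. Qed.

Lemma abs2_lin (a z w : C) :
  abs2 (a * z + w) <= 2 * abs2 a * abs2 z + 2 * abs2 w.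
Proof.
case: a => a b; case: z => p q; case: w => r s.
rewrite /abs2 -[complex.Re (_ + _)]/(a * p - b * q + r).
rewrite -[complex.Im (_ + _)]/(a * q + b * p + s) -subr_ge0 /=.
set X := (X in 0 <= X).
rewrite (_ : X = (a * p - b * q - r) ^+ 2 + (a * q + b * p - s) ^+ 2).
  by rewrite addr_ge0// sqr_ge0.
by rewrite /X; ring.
Qed.

Lemma measurable_abs2 (f : T -> C) : cmeasurable f ->
  measurable_fun setT (EFin \o (fun x => abs2 (f x))).
Proof.
move=> [mR mI]; apply/measurable_EFinP.
by apply: measurable_funD; apply: measurable_funX.
Qed.

Lemma cmeasurable_lin (a : C) (f g : T -> C) :
  cmeasurable f -> cmeasurable g -> cmeasurable (a *: f + g).
Proof.
move=> [fR fI] [gR gI]; case: a => a b; split.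
  rewrite (_ : (fun x => _) = fun x => a * complex.Re (f x)
      - b * complex.Im (f x) + complex.Re (g x)).
    by apply: measurable_funD => //; apply: measurable_funB;
       apply: measurable_funM.
  by apply/funext => x; rewrite /GRing.scale/= /GRing.add/=; case: (f x); case: (g x).
rewrite (_ : (fun x => _) = fun x => a * complex.Im (f x)
      + b * complex.Re (f x) + complex.Im (g x)).
  by apply: measurable_funD => //; apply: measurable_funD;
     apply: measurable_funM.
by apply/funext => x; rewrite /GRing.scale/= /GRing.add/=; case: (f x); case: (g x).
Qed.

Lemma square_integrable_submod_closed : submod_closed square_integrable.
Proof.
split.
  rewrite inE; split.
    by split; exact: measurable_cst.
  rewrite integral0_eq// => x _.
  by rewrite /= /abs2/= expr0n addr0.
move=> a f g; rewrite !inE => -[mf f2] [mg g2].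
have mfg := cmeasurable_lin a mf mg; split => //.
pose k : R := 2 * abs2 a.
have k0 : 0 <= k by rewrite mulr_ge0// abs2_ge0.
apply: (@le_lt_trans _ _ (\int[mu]_x (k%:E * (abs2 (f x))%:E
    + 2%:E * (abs2 (g x))%:E))%E).
  apply: ge0_le_integral => //=.
  - by move=> x _; rewrite lee_fin abs2_ge0.
  - exact: measurable_abs2.
  - by apply: emeasurable_funD; apply: emeasurable_funM => //; exact: measurable_abs2.
  by move=> x _; rewrite -!EFinM -EFinD lee_fin abs2_lin.
have m2 (h : T -> C) : cmeasurable h ->
    measurable_fun setT (fun x => (abs2 (h x))%:E).
  exact: measurable_abs2.
rewrite ge0_integralD//; first last.
- by apply: emeasurable_funM => //; exact: m2.
- by move=> x _; rewrite mule_ge0// lee_fin abs2_ge0.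
- by apply: emeasurable_funM => //; exact: m2.
- by move=> x _; rewrite mule_ge0// lee_fin abs2_ge0.
rewrite !ge0_integralZl//; first last.
- by move=> x _; rewrite lee_fin abs2_ge0.
- exact: m2.
- by move=> x _; rewrite lee_fin abs2_ge0.
- exact: m2.
by rewrite lte_add_pinfty// lte_mul_pinfty// ?lee_fin.
Qed.

HB.instance Definition _ :=
  GRing.isSubmodClosed.Build C (T -> C) square_integrable
    square_integrable_submod_closed.

Record L2fun := MkL2fun {
  L2fun_val :> T -> C ;
  _ : L2fun_val \in square_integrable }.

HB.instance Definition _ := [isSub for L2fun_val].
HB.instance Definition _ := [Choice of L2fun by <:].
HB.instance Definition _ := [SubChoice_isSubLmodule of L2fun by <:].

Definition ae_null : {pred L2fun} :=
  mem [set f : L2fun | {ae mu, forall x, f x = 0}].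

Lemma ae_null_submod_closed : submod_closed ae_null.
Proof.
split; first by rewrite inE; exact: aeW.
move=> a f g; rewrite !inE => f0 g0.
apply: filterS2 f0 g0 => x f0 g0.
by rewrite -[LHS]/(a *: (f x) + g x) f0 g0 scaler0 addr0.
Qed.

HB.instance Definition _ :=
  GRing.isSubmodClosed.Build C L2fun ae_null ae_null_submod_closed.

Definition L2 : Type := Quotient.quot ae_null.

HB.instance Definition _ := Choice.on L2.
HB.instance Definition _ := GRing.Zmodule.on L2.
HB.instance Definition _ := EqQuotient.on L2.

Local Open Scope quotient_scope.

(* class of f; the default value 0 is only reached when f is not square
   integrable *)
Definition L2_of (f : T -> C) : L2 := \pi_L2 (insubd (0 : L2fun) f).

Definition L2_scale (a : C) (u : L2) : L2 := \pi_L2 (a *: repr u).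

Lemma L2_eqP (f g : L2fun) :
  \pi_L2 f = \pi_L2 g <-> {ae mu, forall x, f x = g x}.
Proof.
split=> [/eqP|fg].
  rewrite -Quotient.idealrBE inE.
  by apply: filterS => x /eqP; rewrite subr_eq0 => /eqP.
apply/eqP; rewrite -Quotient.idealrBE inE.
by apply: filterS fg => x fg; rewrite -[LHS]/(f x - g x) fg subrr.
Qed.

Lemma pi_L2D (f g : L2fun) : \pi_L2 (f + g) = \pi_L2 f + \pi_L2 g.
Proof. exact: (@Quotient.pi_add _ ae_null). Qed.

Lemma pi_L2Z (a : C) (f : L2fun) : \pi_L2 (a *: f) = L2_scale a (\pi_L2 f).
Proof.
apply/L2_eqP; have /L2_eqP : \pi_L2 f = \pi_L2 (repr (\pi_L2 f)).
  by rewrite reprK.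
by apply: filterS => x fx; rewrite -[LHS]/(a *: f x) fx.
Qed.

Let scaleA (a b : C) (u : L2) :
  L2_scale a (L2_scale b u) = L2_scale (a * b) u.
Proof.
elim/quotW: u => f.
by rewrite -(pi_L2Z b f) -(pi_L2Z a (b *: f)) -(pi_L2Z (a * b) f) scalerA.
Qed.

Let scale1 : left_id 1 L2_scale.
Proof. by elim/quotW=> f; rewrite -(pi_L2Z 1 f) scale1r. Qed.

Let scaleDr : right_distributive L2_scale +%R.
Proof.
move=> a; elim/quotW=> f; elim/quotW=> g.
by rewrite -(pi_L2Z a f) -(pi_L2Z a g) -!pi_L2D -(pi_L2Z a (f + g)) scalerDr.
Qed.

Let scaleDl (u : L2) : {morph L2_scale^~ u : a b / a + b}.
Proof.
move=> a b; elim/quotW: u => f.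
by rewrite -(pi_L2Z a f) -(pi_L2Z b f) -(pi_L2Z (a + b) f) -pi_L2D scalerDl.
Qed.

HB.instance Definition _ :=
  GRing.Zmodule_isLmodule.Build C L2 scaleA scale1 scaleDr scaleDl.

Definition cintegral (f : T -> C) : C :=
  Complex (\int[mu]_x complex.Re (f x)) (\int[mu]_x complex.Im (f x)).

Definition cintegrable (f : T -> C) : Prop :=
  mu.-integrable setT (fun x => (complex.Re (f x))%:E) /\
  mu.-integrable setT (fun x => (complex.Im (f x))%:E).

Definition L2dot (u v : L2) : C :=
  cintegral (fun x => repr u x * conjc (repr v x)).

Definition L2norm (u : L2) : R :=
  Num.sqrt (\int[mu]_x abs2 (repr u x)).

End L2.

Section operators.
Context d (T : measurableType d) (R : realType).
Variable mu : {measure set T -> \bar R}.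

Local Notation L2 := (L2 mu).

(* [\bar R]-valued, hence +oo for an unbounded operator *)
Definition opnorm (A : L2 -> L2) : \bar R :=
  ereal_sup [set (L2norm (A u))%:E | u in [set u | L2norm u <= 1]].

Definition commutator (A B : L2 -> L2) : L2 -> L2 := (A \o B) - (B \o A).

(* [adjoint] and [orth_proj] pick the (unique) element with the stated property;
   [xget] returns 0 if there is none *)
Definition adjoint (A : L2 -> L2) (v : L2) : L2 :=
  xget 0 [set w | forall u, L2dot (A u) v = L2dot u w].

Definition orth_proj (V : set L2) (u : L2) : L2 :=
  xget 0 [set w | V w /\ forall v, V v -> L2dot (u - w) v = 0].

Definition eigenproj (A : L2 -> L2) (a : R[i]) : L2 -> L2 :=
  orth_proj [set u | A u = a *: u].

Definition is_unitary (U : L2 -> L2) : Prop :=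
  [/\ linear U, (forall v, exists u, U u = v) &
      forall u v, L2dot (U u) (U v) = L2dot u v].

Definition mult_indic (I : set T) (u : L2) : L2 :=
  L2_of mu (fun x => if x \in I then repr u x else 0).

End operators.

Section fourier.
Context (R : realType) (n : nat).

Local Notation mu := (@lebesgue_Rn R n).

Definition Rn_dot (x y : Rn R n) : R :=
  \sum_(i < n) tnth (x : n.-tuple R) i * tnth (y : n.-tuple R) i.

(* e^(it) *)
Definition cexpi (t : R) : R[i] := Complex (cos t) (sin t).

Definition fourier_integral (f : Rn R n -> R[i]) (xi : Rn R n) : R[i] :=
  cintegral mu (fun x => f x * cexpi (- (2 * pi * Rn_dot x xi))).

(* This determines U, because L1 `&` L2 is dense in L2; that such a U exists is
   Plancherel's theorem. *)
Definition is_fourier_plancherel (U : L2 mu -> L2 mu) : Prop :=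
  is_unitary U /\
  forall u : L2 mu, cintegrable mu (repr u) ->
    {ae mu, forall xi, repr (U u) xi = fourier_integral (repr u) xi}.

Definition fourier_log (U : L2 mu -> L2 mu) : L2 mu -> L2 mu :=
  (- pi)%:C%C *: eigenproj U (-1) + (pi / 2)%:C%C *: eigenproj U 'i%C
  - (pi / 2)%:C%C *: eigenproj U (- 'i%C).

Definition projP (I : set (Rn R n)) : L2 mu -> L2 mu := @mult_indic _ _ _ mu I.

Definition projQ (U : L2 mu -> L2 mu) (I : set (Rn R n)) : L2 mu -> L2 mu :=
  adjoint U \o projP I \o U.

End fourier.

(* Main.v *)
Require Import Defs.
From HB Require Import structures.
From mathcomp Require Import all_boot all_order all_algebra.
From mathcomp Require Import all_classical all_reals all_analysis.
From mathcomp Require Import measurable_realfun.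
From mathcomp.real_closed Require Import complex.
From mathcomp Require Import ring lra.

Set Implicit Arguments.
Unset Strict Implicit.
Unset Printing Implicit Defensive.

Import Order.TTheory GRing.Theory Num.Theory.
Import numFieldNormedType.Exports.

Local Open Scope classical_set_scope.
Local Open Scope ring_scope.

(** Write [P], [Q] for the two projections attached to [I], [R] for the operator
[(R f)(x) = f(-x)], and [U] for the Fourier transform.

The logarithm is a polynomial in [U].  If [U^4 = 1], the spectral projection for
an eigenvalue [a] is the average of [a^-k U^k] over [k < 4]
([eigenproj_order4]), so that ([fourier_logE])
[[
  H = (pi / 4) ((1 - i) U + (1 + i) U^3 - U^2 - 1).
]]
In particular [H] commutes with [U], whence [[H, Q] = U^-1 [H, P] U], and the two
commutators have the same norm because [U] is unitary
([opnorm_commutator_projQ]).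

The relation [U^4 = 1] is a form of Fourier inversion.  For [u] and [v] both
integrable and square integrable, Fubini's theorem gives
[<U u, v> = <u, R U v>] ([fourier_dot]): the kernel [e^(-2 pi i x . xi)] is
symmetric, and conjugating it amounts to reflecting one variable.  Such functions
are total in [L^2], and [U] is unitary, so [U R U = 1]
([fourier_parity_fourier]), that is [U^2 = R] ([fourier_sq]).  This uses that
Lebesgue measure is invariant under reflection, which is obtained on intervals,
then on products, and then on the completion.

For the lower bound, let [e] be the normalized indicator function of a subset [A]
of [I] of small positive measure.  The function [U e] is bounded by a multiple of
[|A|^(1/2)], and so is [U^3 e = R U e]; as [|I|] is finite, only a part
[O(|A| |I|)] of their squared norms lives on [I] ([test_vector]).  From [P e = e]
one gets
[[
  [H, P] e = (1 - P) H e = (pi / 4) (1 - P) w,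
  w = (1 - i) U e + (1 + i) U^3 e - U^2 e.
]]
The scalar [<U e, U^3 e> = <e, U^2 e>] is real and [(1 - i)^2] is imaginary, so
the first two terms of [w] add up to a vector of squared norm exactly [2 + 2 = 4].
This vector is almost orthogonal to the range of [P], and also to [U^2 e].  The
remaining term [U^2 e] has norm [1], and [P] can remove at most that much; so
[|(1 - P) w|^2 >= 4 - o(1)] ([sqn_compl_test_ge]), and the norm of the commutator
is at least [(pi / 4) 2]. *)

(** * Complex numbers *)

Section complex_numbers.
Context (R : realType).
Implicit Types z w : R[i].

Lemma cReD z w : complex.Re (z + w) = complex.Re z + complex.Re w.
Proof. by case: z w => [a b] [c e]. Qed.

Lemma cImD z w : complex.Im (z + w) = complex.Im z + complex.Im w.
Proof. by case: z w => [a b] [c e]. Qed.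

Lemma cReM z w : complex.Re (z * w) =
  complex.Re z * complex.Re w - complex.Im z * complex.Im w.
Proof. by case: z w => [a b] [c e]. Qed.

Lemma cImM z w : complex.Im (z * w) =
  complex.Re z * complex.Im w + complex.Im z * complex.Re w.
Proof. by case: z w => [a b] [c e]. Qed.

Lemma cReN z : complex.Re (- z) = - complex.Re z.
Proof. by case: z. Qed.

Lemma cImN z : complex.Im (- z) = - complex.Im z.
Proof. by case: z. Qed.

Lemma cRe1 : complex.Re (1 : R[i]) = 1.
Proof. by []. Qed.

Lemma Re_conjc z : complex.Re (conjc z) = complex.Re z.
Proof. by case: z. Qed.

Lemma Im_conjc z : complex.Im (conjc z) = - complex.Im z.
Proof. by case: z. Qed.

Lemma eq_complexP z w : complex.Re z = complex.Re w ->
  complex.Im z = complex.Im w -> z = w.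
Proof. by case: z w => [a b] [c e] /= -> ->. Qed.

(** The taxicab norm of a complex number.  Constants are irrelevant in the bounds
below, and this norm is submultiplicative, controls both components and avoids
square roots. *)
Definition l1norm z : R := `|complex.Re z| + `|complex.Im z|.

Lemma l1norm_ge0 z : 0 <= l1norm z.
Proof. by rewrite addr_ge0. Qed.

Lemma Re_le_l1norm z : `|complex.Re z| <= l1norm z.
Proof. by rewrite lerDl. Qed.

Lemma Im_le_l1norm z : `|complex.Im z| <= l1norm z.
Proof. by rewrite lerDr. Qed.

Lemma l1normM z w : l1norm (z * w) <= l1norm z * l1norm w.
Proof.
rewrite /l1norm cReM cImM mulrDl !mulrDr -!normrM.
rewrite (le_trans (lerD (ler_normB _ _) (ler_normD _ _)))//.
by rewrite addrACA -addrA -[leRHS]addrA lerD2l addrCA addrC -addrA.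
Qed.

Lemma l1norm_conjc z : l1norm (conjc z) = l1norm z.
Proof. by rewrite /l1norm Re_conjc Im_conjc normrN. Qed.

Lemma abs2_le_l1norm z : abs2 z <= l1norm z ^+ 2.
Proof.
rewrite /abs2 /l1norm sqrrD !real_normK ?num_real//.
by rewrite -addrA lerD2l lerDr mulrn_wge0// mulr_ge0.
Qed.

Lemma l1norm_le_abs2 z : l1norm z ^+ 2 <= 2 * abs2 z.
Proof.
rewrite /abs2 /l1norm -(real_normK (num_real (complex.Re z))).
rewrite -(real_normK (num_real (complex.Im z))).
rewrite -subr_ge0; set a := `|complex.Re z|; set b := `|complex.Im z|.
rewrite (_ : _ - _ = (a - b) ^+ 2) ?sqr_ge0//; ring.
Qed.

Lemma l1normM_le_abs2 z w : l1norm (z * conjc w) <= abs2 z + abs2 w.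
Proof.
rewrite (le_trans (l1normM _ _))// l1norm_conjc.
have := l1norm_le_abs2 z; have := l1norm_le_abs2 w.
have := sqr_ge0 (l1norm z - l1norm w).
by set a := l1norm z; set b := l1norm w => h1 h2 h3; nra.
Qed.

Lemma conjcM z w : conjc (z * w) = conjc z * conjc w.
Proof. exact: rmorphM. Qed.

Lemma conjcD z w : conjc (z + w) = conjc z + conjc w.
Proof. exact: rmorphD. Qed.

Lemma conjcN z : conjc (- z) = - conjc z.
Proof. exact: rmorphN. Qed.

Lemma mul_conjc z : z * conjc z = (abs2 z)%:C%C.
Proof. by case: z => a b; apply: eq_complexP; rewrite /abs2/=; ring. Qed.

Lemma abs2_eq0 z : abs2 z = 0 -> z = 0.
Proof.
move=> /eqP; rewrite paddr_eq0 ?sqr_ge0// !sqrf_eq0 => /andP[/eqP a /eqP b].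
exact: eq_complexP.
Qed.

End complex_numbers.

(** * Integration of complex-valued functions *)

Section complex_integration.
Context d (T : measurableType d) (R : realType).
Variable mu : {measure set T -> \bar R}.
Implicit Types (f g : T -> R[i]) (a : R[i]).

Lemma cmeasurableM f g :
  cmeasurable f -> cmeasurable g -> cmeasurable (fun x => f x * g x).
Proof.
move=> [fR fI] [gR gI]; split.
  by under eq_fun do rewrite cReM; apply: measurable_funB; apply: measurable_funM.
by under eq_fun do rewrite cImM; apply: measurable_funD; apply: measurable_funM.
Qed.

Lemma cmeasurableD f g :
  cmeasurable f -> cmeasurable g -> cmeasurable (fun x => f x + g x).
Proof.
move=> [fR fI] [gR gI]; split.
  by under eq_fun do rewrite cReD; apply: measurable_funD.
by under eq_fun do rewrite cImD; apply: measurable_funD.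
Qed.

Lemma cmeasurable_cst a : cmeasurable (fun _ : T => a).
Proof. by split; exact: measurable_cst. Qed.

Lemma cmeasurable_conjc f : cmeasurable f -> cmeasurable (fun x => conjc (f x)).
Proof.
move=> [fR fI]; split; first by under eq_fun do rewrite Re_conjc.
by under eq_fun do rewrite Im_conjc; apply: measurableT_comp.
Qed.

Lemma cmeasurable_if (I : set T) f : measurable I -> cmeasurable f ->
  cmeasurable (fun x => if x \in I then f x else 0).
Proof.
move=> mI [fR fI].
have mb : measurable_fun [set: T] (fun x => x \in I).
  apply: (measurable_fun_bool true); rewrite setTI.
  rewrite (_ : _ @^-1` _ = I)//; apply/seteqP; split=> x /=; first exact: set_mem.
  by move=> Ix; rewrite mem_set.
split.
  rewrite (_ : (fun _ => _) = fun x => if x \in I then complex.Re (f x) else 0).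
    by apply: measurable_fun_ifT => //; exact: measurable_cst.
  by apply/funext => x; case: ifP.
rewrite (_ : (fun _ => _) = fun x => if x \in I then complex.Im (f x) else 0).
  by apply: measurable_fun_ifT => //; exact: measurable_cst.
by apply/funext => x; case: ifP.
Qed.

Lemma measurable_l1norm f : cmeasurable f ->
  measurable_fun setT (fun x => l1norm (f x)).
Proof. by move=> [fR fI]; apply: measurable_funD; apply: measurableT_comp. Qed.

Lemma cintegrable_cmeasurable f : cintegrable mu f -> cmeasurable f.
Proof.
by move=> [/measurable_int/measurable_EFinP ? /measurable_int/measurable_EFinP ?].
Qed.

Lemma le_cintegrable f (g : T -> R) : cmeasurable f ->
  (forall x, l1norm (f x) <= g x) -> mu.-integrable setT (EFin \o g) ->
  cintegrable mu f.
Proof.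
move=> [fR fI] fg ig.
have g0 x : 0 <= g x by rewrite (le_trans (l1norm_ge0 _) (fg _)).
split; apply: le_integrable ig => //; try exact/measurable_EFinP.
- move=> x _ /=; rewrite lee_fin (ger0_norm (g0 x)) (le_trans _ (fg x))//.
  exact: Re_le_l1norm.
- move=> x _ /=; rewrite lee_fin (ger0_norm (g0 x)) (le_trans _ (fg x))//.
  exact: Im_le_l1norm.
Qed.

Lemma cintegrable_l1norm f : cintegrable mu f ->
  mu.-integrable setT (EFin \o (fun x => l1norm (f x))).
Proof.
move=> [fR fI].
rewrite (_ : _ \o _ =
    (fun x => `|(complex.Re (f x))%:E|) \+ (fun x => `|(complex.Im (f x))%:E|))%E //.
by apply: integrableD => //; exact: integrable_abse.
Qed.

Lemma ae_cintegrable f g : cmeasurable f ->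
  {ae mu, forall x, f x = g x} -> cintegrable mu g -> cintegrable mu f.
Proof.
move=> [fR fI] fg [gR gI].
have E (h k : T -> R) : measurable_fun setT h ->
    {ae mu, forall x, h x = k x} -> mu.-integrable setT (EFin \o k) ->
    mu.-integrable setT (EFin \o h).
  move=> mh hk ik; apply/integrableP; split; first exact/measurable_EFinP.
  have /integrableP[mk koo] := ik.
  rewrite (ge0_ae_eq_integral (g := fun x => `|(EFin \o k) x|%E))//.
  - by apply: measurableT_comp => //; exact/measurable_EFinP.
  - exact: measurableT_comp.
  - by apply: filterS hk => x hk _ /=; rewrite hk.
by split; [apply: E gR|apply: E gI] => //; apply: filterS fg => x ->.
Qed.

Lemma cintegralD f g : cintegrable mu f -> cintegrable mu g ->
  cintegral mu (fun x => f x + g x) = cintegral mu f + cintegral mu g.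
Proof.
move=> [fR fI] [gR gI]; apply: eq_complexP; rewrite ?cReD ?cImD /=.
  by under eq_Rintegral do rewrite cReD; rewrite RintegralD.
by under eq_Rintegral do rewrite cImD; rewrite RintegralD.
Qed.

Lemma cintegralZ a f : cintegrable mu f ->
  cintegral mu (fun x => a * f x) = a * cintegral mu f.
Proof.
move=> [fR fI]; apply: eq_complexP; rewrite ?cReM ?cImM /=.
  under eq_Rintegral do rewrite cReM.
  rewrite RintegralB// ?RintegralZl//.
  - exact: (integrableZl measurableT _ fR).
  - exact: (integrableZl measurableT _ fI).
under eq_Rintegral do rewrite cImM.
rewrite RintegralD// ?RintegralZl//.
- exact: (integrableZl measurableT _ fI).
- exact: (integrableZl measurableT _ fR).
Qed.

Lemma cintegral_conjc f : cintegrable mu f ->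
  cintegral mu (fun x => conjc (f x)) = conjc (cintegral mu f).
Proof.
move=> [fR fI]; apply: eq_complexP; rewrite ?Re_conjc ?Im_conjc /=.
  by under eq_Rintegral do rewrite Re_conjc.
under eq_Rintegral do rewrite Im_conjc -mulN1r.
by rewrite RintegralZl// mulN1r.
Qed.

Lemma eq_cintegral f g : f =1 g -> cintegral mu f = cintegral mu g.
Proof. by move=> /funext ->. Qed.

Lemma ae_eq_cintegral f g : cmeasurable f -> cmeasurable g ->
  {ae mu, forall x, f x = g x} -> cintegral mu f = cintegral mu g.
Proof.
move=> [fR fI] [gR gI] fg; congr Complex; congr fine; apply: ae_eq_integral => //;
  try exact/measurable_EFinP; by apply: filterS fg => x ->.
Qed.

Lemma l1norm_cintegral_le f : cintegrable mu f ->
  l1norm (cintegral mu f) <= \int[mu]_x l1norm (f x).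
Proof.
move=> [fR fI]; rewrite RintegralD//; last 2 first.
- exact: (integrable_abse fR).
- exact: (integrable_abse fI).
by rewrite lerD//; exact: le_normr_Rintegral.
Qed.

End complex_integration.

Section measure_preserving.
Context d (T : measurableType d) (R : realType).
Variables (mu : {measure set T -> \bar R}) (s : T -> T).
Hypotheses (ms : measurable_fun setT s)
  (mus : forall A, measurable A -> mu (s @^-1` A) = mu A).

Lemma ae_preserving (P : T -> Prop) :
  {ae mu, forall x, P x} -> {ae mu, forall x, P (s x)}.
Proof.
move=> [N [mN N0 PN]]; exists (s @^-1` N); split.
- by rewrite -[X in measurable X]setTI; exact: ms.
- by rewrite -N0; exact: mus.
- by move=> x /= Px; apply: PN.
Qed.

Lemma ge0_integral_preserving (f : T -> \bar R) :
  measurable_fun setT f -> (forall x, 0 <= f x)%E ->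
  (\int[mu]_x f (s x) = \int[mu]_x f x)%E.
Proof.
move=> mf f0.
transitivity (\int[pushforward mu s]_x f x)%E.
  by rewrite ge0_integral_pushforward.
pose nu : {measure set T -> \bar R} :=
  measure_function_pushforward__canonical__measure_function_Measure mu ms.
by apply: (@eq_measure_integral _ _ _ setT mu nu) => A mA _; exact: mus.
Qed.

Lemma cintegral_preserving (f : T -> R[i]) : cmeasurable f ->
  cintegral mu (fun x => f (s x)) = cintegral mu f.
Proof.
move=> [fR fI].
have E (g : T -> R) : measurable_fun setT g ->
    \int[mu]_x g (s x) = \int[mu]_x g x.
  move=> mg; congr fine.
  rewrite -[fun x => (g (s x))%:E]/((EFin \o g) \o s) integralE [in RHS]integralE.
  rewrite funepos_comp funeneg_comp.
  have me : measurable_fun setT (EFin \o g) by exact/measurable_EFinP.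
  congr (_ - _)%E.
    apply: (ge0_integral_preserving (f := (EFin \o g)^\+%E)) => //.
    exact: measurable_funepos.
  apply: (ge0_integral_preserving (f := (EFin \o g)^\-%E)) => //.
  exact: measurable_funeneg.
by congr Complex; [exact: (E (fun x => complex.Re (f x)))|
                   exact: (E (fun x => complex.Im (f x)))].
Qed.

End measure_preserving.

Section sf_measure.
Context d (T : measurableType d) (R : realType).
Variable mu : {measure set T -> \bar R}.

(** A copy of [mu] for which sigma-finiteness, a mere hypothesis on [mu], is found
by type inference. *)
Definition sf_measure of sigma_finite setT mu : set T -> \bar R := mu.

Hypothesis s : sigma_finite setT mu.

HB.instance Definition _ := Measure.copy (sf_measure s) mu.
HB.instance Definition _ := Measure_isSigmaFinite.Build _ _ _ (sf_measure s) s.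

End sf_measure.

Section complex_fubini.
Context d1 d2 (T1 : measurableType d1) (T2 : measurableType d2) (R : realType).
Variables (m1 : {measure set T1 -> \bar R}) (m2 : {measure set T2 -> \bar R}).
Hypotheses (s1 : sigma_finite setT m1) (s2 : sigma_finite setT m2).

Let m1' := sf_measure s1.
Let m2' := sf_measure s2.

Section real_kernel.
Variables (K : T1 * T2 -> R) (f : T1 -> R) (g : T2 -> R).
Hypotheses (mK : measurable_fun setT K)
  (Kfg : forall x y, `|K (x, y)| <= f x * g y)
  (If : m1.-integrable setT (EFin \o f)) (Ig : m2.-integrable setT (EFin \o g)).

Let IK1 y : m1.-integrable setT (fun x => (K (x, y))%:E).
Proof.
apply: (@le_integrable _ _ _ _ _ measurableT _ (fun x => (f x * g y)%:E)).
- apply/measurable_EFinP; apply: measurableT_comp mK _.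
  exact: measurable_pair2.
- by move=> x _; rewrite /= lee_fin (le_trans (Kfg x y))// ler_norm.
- under eq_fun do rewrite mulrC.
  exact: (integrableZl measurableT _ If).
Qed.

Let IK2 x : m2.-integrable setT (fun y => (K (x, y))%:E).
Proof.
apply: (@le_integrable _ _ _ _ _ measurableT _ (fun y => (f x * g y)%:E)).
- apply/measurable_EFinP; apply: measurableT_comp mK _.
  exact: measurable_pair1.
- by move=> y _; rewrite /= lee_fin (le_trans (Kfg x y))// ler_norm.
- exact: (integrableZl measurableT _ Ig).
Qed.

Let IK : (m1' \x m2')%E.-integrable setT (EFin \o K).
Proof.
have mKe : measurable_fun setT (EFin \o K) by exact/measurable_EFinP.
apply/integrable12ltyP => //.
apply: (@le_lt_trans _ _ (\int[m1]_x `|(f x * \int[m2]_y g y)%:E|)%E); last first.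
  suff /integrableP[] : m1.-integrable setT (fun x => (f x * \int[m2]_y g y)%:E) by [].
  under eq_fun do rewrite mulrC.
  exact: (integrableZl measurableT _ If).
apply: ge0_le_integral => //.
- by move=> x _; exact: integral_ge0.
- apply: (measurable_fun_fubini_tonelli_F (m2 := m2') (abse \o (EFin \o K))).
    exact: measurableT_comp.
  by move=> p; exact: abse_ge0.
- apply: measurableT_comp => //; apply/measurable_EFinP.
  by apply: measurable_funM => //; apply/measurable_EFinP/(measurable_int m1).
move=> x _ /=.
rewrite -RintegralZl// EFin_normr_Rintegral//; last first.
  exact: (integrableZl measurableT _ Ig).
have -> : (`|\int[m2]_y (f x * g y)%:E| = \int[m2]_y (f x * g y)%:E)%E.
  by rewrite gee0_abs// integral_ge0// => y _; rewrite lee_fin (le_trans _ (Kfg x y)).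
apply: ge0_le_integral => //.
- exact: measurable_int (integrable_abse (IK2 x)).
- exact: measurable_int (integrableZl measurableT (f x) Ig).
- by move=> y _; rewrite lee_fin.
Qed.

Lemma measurable_Rintegral_fst :
  measurable_fun setT (fun y => \int[m1]_x K (x, y)).
Proof.
exact: measurableT_comp (fine_measurable measurableT) (measurable_fubini_G IK).
Qed.

Lemma measurable_Rintegral_snd :
  measurable_fun setT (fun x => \int[m2]_y K (x, y)).
Proof.
exact: measurableT_comp (fine_measurable measurableT) (measurable_fubini_F IK).
Qed.

Lemma Rintegral_fubini :
  \int[m2]_y (\int[m1]_x K (x, y)) = \int[m1]_x (\int[m2]_y K (x, y)).
Proof.
rewrite /Rintegral; congr fine.
transitivity (\int[m2']_y \int[m1']_x (EFin \o K) (x, y))%E.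
  by apply: eq_integral => y _; rewrite fineK//; exact: integrable_fin_num (IK1 y).
rewrite -Fubini//; apply: eq_integral => x _.
by rewrite fineK//; exact: integrable_fin_num (IK2 x).
Qed.

End real_kernel.

Variables (K : T1 * T2 -> R[i]) (f : T1 -> R) (g : T2 -> R).
Hypotheses (mK : cmeasurable K)
  (Kfg : forall x y, l1norm (K (x, y)) <= f x * g y)
  (If : m1.-integrable setT (EFin \o f)) (Ig : m2.-integrable setT (EFin \o g)).

Let KR x y : `|complex.Re (K (x, y))| <= f x * g y.
Proof. exact: le_trans (Re_le_l1norm _) (Kfg x y). Qed.

Let KI x y : `|complex.Im (K (x, y))| <= f x * g y.
Proof. exact: le_trans (Im_le_l1norm _) (Kfg x y). Qed.

(** A function that is only almost everywhere equal to a measurable one may be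
replaced by it under an integral as soon as it is known to be measurable; this is
what the two following lemmas provide for partial integrals. *)
Lemma cmeasurable_cintegral_fst :
  cmeasurable (fun y => cintegral m1 (fun x => K (x, y))).
Proof.
split.
  exact: (measurable_Rintegral_fst (K := fun p => complex.Re (K p)) mK.1 KR If Ig).
exact: (measurable_Rintegral_fst (K := fun p => complex.Im (K p)) mK.2 KI If Ig).
Qed.

Lemma cmeasurable_cintegral_snd :
  cmeasurable (fun x => cintegral m2 (fun y => K (x, y))).
Proof.
split.
  exact: (measurable_Rintegral_snd (K := fun p => complex.Re (K p)) mK.1 KR If Ig).
exact: (measurable_Rintegral_snd (K := fun p => complex.Im (K p)) mK.2 KI If Ig).
Qed.

Lemma cintegral_fubini :
  cintegral m2 (fun y => cintegral m1 (fun x => K (x, y))) =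
  cintegral m1 (fun x => cintegral m2 (fun y => K (x, y))).
Proof.
congr Complex.
  exact: (Rintegral_fubini (K := fun p => complex.Re (K p)) mK.1 KR If Ig).
exact: (Rintegral_fubini (K := fun p => complex.Im (K p)) mK.2 KI If Ig).
Qed.

End complex_fubini.

(** * Inner products and almost orthogonal projections *)

Section inner_product.
Context (R : realType) (V : lmodType R[i]) (dot : V -> V -> R[i]).
Hypotheses (dotDl : forall u v w, dot (u + v) w = dot u w + dot v w)
  (dotZl : forall a u v, dot (a *: u) v = a * dot u v)
  (dotC : forall u v, dot v u = conjc (dot u v))
  (dot_ge0 : forall u, 0 <= complex.Re (dot u u)).
Implicit Types (u v w : V) (a b : R[i]).

Local Notation sqn u := (complex.Re (dot u u)).

Lemma dotDr u v w : dot w (u + v) = dot w u + dot w v.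
Proof. by rewrite dotC dotDl conjcD -!dotC. Qed.

Lemma dotZr a u v : dot u (a *: v) = conjc a * dot u v.
Proof. by rewrite dotC dotZl conjcM -dotC. Qed.

Lemma dotNl u v : dot (- u) v = - dot u v.
Proof. by rewrite -scaleN1r dotZl mulN1r. Qed.

Lemma dotNr u v : dot u (- v) = - dot u v.
Proof. by rewrite dotC dotNl conjcN -dotC. Qed.

Lemma sqnD u v : sqn (u + v) = sqn u + sqn v + 2 * complex.Re (dot u v).
Proof. by rewrite dotDl !dotDr (dotC u v) !cReD Re_conjc; ring. Qed.

Lemma sqnN u : sqn (- u) = sqn u.
Proof. by rewrite dotNl dotNr opprK. Qed.

Lemma sqnB u v : sqn (u - v) = sqn u + sqn v - 2 * complex.Re (dot u v).
Proof. by rewrite sqnD sqnN dotNr cReN mulrN. Qed.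

Lemma sqnZ a u : sqn (a *: u) = abs2 a * sqn u.
Proof. by rewrite dotZl dotZr mulrA mul_conjc cReM mul0r subr0. Qed.

Lemma sqnD_le u v : sqn (u + v) <= 2 * sqn u + 2 * sqn v.
Proof. by have := dot_ge0 (u - v); rewrite sqnB sqnD; lra. Qed.

(** This replaces the Cauchy-Schwarz inequality: it is the expansion of
    [0 <= |t u - v|^2]. *)
Lemma Re_dot_le (t : R) u v : 0 < t ->
  2 * complex.Re (dot u v) <= t * sqn u + t^-1 * sqn v.
Proof.
move=> t0; have := dot_ge0 (t%:C%C *: u - v).
rewrite sqnB sqnZ dotZl cReM /abs2/= mul0r subr0 => h.
by rewrite -(ler_pM2l t0) mulrDr (mulrA t t^-1) divff ?gt_eqF// mul1r; lra.
Qed.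

Section orthogonal_projection.
Variable P : V -> V.
Hypotheses (PD : forall u v, P (u + v) = P u + P v)
  (PZ : forall a u, P (a *: u) = a *: P u)
  (PP : forall u, P (P u) = P u)
  (Padj : forall u v, dot (P u) v = dot u (P v)).

Lemma sqn_proj_compl u : sqn (u - P u) = sqn u - sqn (P u).
Proof. by rewrite sqnB Padj PP; ring. Qed.

Lemma sqn_proj_le u : sqn (P u) <= sqn u.
Proof. by have := dot_ge0 (u - P u); rewrite sqn_proj_compl subr_ge0. Qed.

Lemma sqn_proj_comb_le a b (s : R) u v :
  abs2 a = 2 -> abs2 b = 2 -> sqn (P u) <= s -> sqn (P v) <= s ->
  sqn (P (a *: u + b *: v)) <= 8 * s.
Proof.
move=> a2 b2; rewrite PD !PZ.
by have := sqnD_le (a *: P u) (b *: P v); rewrite !sqnZ a2 b2; lra.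
Qed.

Variable U : V -> V.
Hypotheses (UD : forall u v, U (u + v) = U u + U v)
  (UZ : forall a u, U (a *: u) = a *: U u)
  (Udot : forall u v, dot (U u) (U v) = dot u v)
  (U4 : forall u, U (U (U (U u))) = u).

(** With [w = (1 - i) U e + (1 + i) U^3 e - U^2 e], the two odd terms have total
mass [4] because [<e, U^2 e>] is real; they are almost orthogonal to the range
of [P], hence to [e] and to [P U^2 e]. *)
Lemma sqn_compl_test_ge (t : R) e w : 0 < t -> P e = e -> dot e e = 1 ->
  sqn (P (U e)) <= t ^+ 2 -> sqn (P (U (U (U e)))) <= t ^+ 2 ->
  w = Complex 1 (-1) *: U e + Complex 1 1 *: U (U (U e)) - U (U e) ->
  4 - 18 * t - 8 * t ^+ 2 <= sqn (w - P w).
Proof.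
move=> t0 Pe ee U1 U3 wE.
set a : R[i] := Complex 1 (-1) in wE; set b : R[i] := Complex 1 1 in wE.
have a2 : abs2 a = 2 by rewrite /abs2/=; ring.
have b2 : abs2 b = 2 by rewrite /abs2/=; ring.
set v := a *: U e + b *: U (U (U e)) in wE.
pose v' := b *: U e + a *: U (U (U e)).
have Pv : sqn (P v) <= 8 * t ^+ 2 by exact: sqn_proj_comb_le.
have Pv' : sqn (P v') <= 8 * t ^+ 2 by exact: sqn_proj_comb_le.
have U2v : U (U v) = v' by rewrite /v !UD !UZ U4 addrC.
have vE : sqn v = 4.
  have real : complex.Im (dot (U e) (U (U (U e)))) = 0.
    have : dot (U e) (U (U (U e))) = conjc (dot (U e) (U (U (U e)))).
      by rewrite -(dotC (U e)) !Udot -(Udot (U (U e))) -(Udot (U (U (U e)))) U4.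
    by case: (dot _ _) => x y [] /eqP; rewrite -addr_eq0 -mulr2n mulrn_eq0/= => /eqP.
  rewrite sqnD !sqnZ a2 b2 !Udot ee dotZl dotZr.
  move: real; rewrite !(cReM, cImM, Re_conjc, Im_conjc) !Udot /= => ->.
  ring.
(* Like [P v], the vector [P v'] is small, where [v' = U^2 v], and [e] lies in the
   range of [P]. *)
have v_tail : 2 * complex.Re (dot v (U (U e))) <= 9 * t.
  have -> : dot v (U (U e)) = conjc (dot e (P v')).
    by rewrite -Padj Pe -U2v -dotC -(Udot v) -(Udot (U v)) U4.
  rewrite Re_conjc (le_trans (Re_dot_le _ _ t0))// ee cRe1 mulr1.
  have : t^-1 * sqn (P v') <= t^-1 * (8 * t ^+ 2) by rewrite ler_pM2l ?invr_gt0.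
  have -> : t^-1 * (8 * t ^+ 2) = 8 * t by field; rewrite gt_eqF.
  lra.
have PU2 : sqn (P (U (U e))) <= 1.
  by have := sqn_proj_le (U (U e)); rewrite !Udot ee.
have Pv_tail : - (2 * complex.Re (dot (P v) (P (U (U e))))) <= 9 * t.
  have := Re_dot_le (P (U (U e))) (- P v) t0.
  rewrite (dotNr (P (U (U e)))) sqnN cReN (dotC (P v)) Re_conjc.
  have : t^-1 * sqn (P v) <= t^-1 * (8 * t ^+ 2) by rewrite ler_pM2l ?invr_gt0.
  have -> : t^-1 * (8 * t ^+ 2) = 8 * t by field; rewrite gt_eqF.
  have : t * sqn (P (U (U e))) <= t by rewrite ger_pMr.
  lra.
have PB x y : P (x - y) = P x - P y by rewrite PD -scaleN1r PZ scaleN1r.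
rewrite sqn_proj_compl wE PB !sqnB vE !Udot ee cRe1.
lra.
Qed.

End orthogonal_projection.

End inner_product.

(** * The Hilbert space of square integrable functions *)

Section L2_space.
Context d (T : measurableType d) (R : realType).
Variable mu : {measure set T -> \bar R}.
Local Open Scope quotient_scope.
Implicit Types (u v w : L2 mu) (a : R[i]) (f g : T -> R[i]).

Lemma L2fun_sqi (f : L2fun mu) : (f : T -> R[i]) \in square_integrable mu.
Proof. exact: valP. Qed.

Lemma L2_cmeasurable u : cmeasurable (repr u).
Proof. by have := L2fun_sqi (repr u); rewrite inE => -[]. Qed.

Lemma L2_lty u : (\int[mu]_x (abs2 (repr u x))%:E < +oo)%E.
Proof. by have := L2fun_sqi (repr u); rewrite inE => -[]. Qed.

Lemma repr_pi (f : L2fun mu) : {ae mu, forall x, repr (\pi_(L2 mu) f) x = f x}.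
Proof. by apply/L2_eqP; rewrite reprK. Qed.

Lemma L2_ext u v : {ae mu, forall x, repr u x = repr v x} -> u = v.
Proof. by move=> /L2_eqP; rewrite !reprK. Qed.

Lemma repr_L2_of f : f \in square_integrable mu ->
  {ae mu, forall x, repr (L2_of mu f) x = f x}.
Proof.
move=> f2; apply: filterS (repr_pi (insubd (0 : L2fun mu) f)) => x ->.
by rewrite insubdK.
Qed.

Lemma square_integrable_le f g : cmeasurable f -> g \in square_integrable mu ->
  (forall x, abs2 (f x) <= abs2 (g x)) -> f \in square_integrable mu.
Proof.
rewrite !inE => mf [mg g2] fg; split => //; apply: le_lt_trans g2.
apply: ge0_le_integral => //.
- by move=> x _; rewrite lee_fin abs2_ge0.
- exact: measurable_abs2.
- exact: measurable_abs2.
- by move=> x _; rewrite lee_fin.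
Qed.

Lemma reprD u v : {ae mu, forall x, repr (u + v) x = repr u x + repr v x}.
Proof.
have -> : u + v = \pi_(L2 mu) (repr u + repr v) by rewrite pi_L2D !reprK.
exact: repr_pi.
Qed.

Lemma reprZ a u : {ae mu, forall x, repr (a *: u) x = a * repr u x}.
Proof. exact: repr_pi. Qed.

Lemma repr0 : {ae mu, forall x, repr (0 : L2 mu) x = 0}.
Proof.
have := reprZ 0 0; rewrite scaler0.
by apply: filterS => x; rewrite mul0r.
Qed.

Lemma cintegrable_dot u v : cintegrable mu (fun x => repr u x * conjc (repr v x)).
Proof.
apply: (@le_cintegrable _ _ _ _ _ (fun x => abs2 (repr u x) + abs2 (repr v x))).
- by apply: cmeasurableM; [|apply: cmeasurable_conjc]; exact: L2_cmeasurable.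
- by move=> x; exact: l1normM_le_abs2.
have int w : mu.-integrable setT (EFin \o (fun x => abs2 (repr w x))).
  apply/integrableP; split; first exact: measurable_abs2 (L2_cmeasurable w).
  under eq_integral do rewrite /= ger0_norm ?abs2_ge0//.
  exact: L2_lty.
exact: (integrableD _ (int u) (int v)).
Qed.

Lemma L2dot_ae u v f g : cmeasurable f -> cmeasurable g ->
  {ae mu, forall x, repr u x = f x} -> {ae mu, forall x, repr v x = g x} ->
  L2dot u v = cintegral mu (fun x => f x * conjc (g x)).
Proof.
move=> mf mg uf vg; apply: ae_eq_cintegral.
- by apply: cmeasurableM; [|apply: cmeasurable_conjc]; exact: L2_cmeasurable.
- by apply: cmeasurableM; [|apply: cmeasurable_conjc].
- by apply: filterS2 uf vg => x -> ->.
Qed.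

Lemma L2dotDl u v w : L2dot (u + v) w = L2dot u w + L2dot v w.
Proof.
rewrite -cintegralD; try exact: cintegrable_dot.
rewrite (@L2dot_ae _ _ (fun x => repr u x + repr v x) (repr w)).
- by apply: eq_cintegral => x; rewrite mulrDl.
- by apply: cmeasurableD; exact: L2_cmeasurable.
- exact: L2_cmeasurable.
- exact: reprD.
- exact: aeW.
Qed.

Lemma L2dotZl a u v : L2dot (a *: u) v = a * L2dot u v.
Proof.
rewrite -cintegralZ; last exact: cintegrable_dot.
rewrite (@L2dot_ae _ _ (fun x => a * repr u x) (repr v)).
- by apply: eq_cintegral => x; rewrite mulrA.
- by apply: cmeasurableM; [exact: cmeasurable_cst|exact: L2_cmeasurable].
- exact: L2_cmeasurable.
- exact: reprZ.
- exact: aeW.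
Qed.

Lemma L2dotC u v : L2dot v u = conjc (L2dot u v).
Proof.
rewrite -cintegral_conjc; last exact: cintegrable_dot.
by apply: eq_cintegral => x; rewrite conjcM conjcK mulrC.
Qed.

Lemma L2dotDr u v w : L2dot w (u + v) = L2dot w u + L2dot w v.
Proof. exact: (dotDr L2dotDl L2dotC). Qed.

Lemma L2dotZr a u v : L2dot u (a *: v) = conjc a * L2dot u v.
Proof. exact: (dotZr L2dotZl L2dotC). Qed.

Lemma L2dotNl u v : L2dot (- u) v = - L2dot u v.
Proof. exact: (dotNl L2dotZl). Qed.

Lemma L2dotNr u v : L2dot u (- v) = - L2dot u v.
Proof. exact: (dotNr L2dotZl L2dotC). Qed.

Lemma L2dotBl u v w : L2dot (u - v) w = L2dot u w - L2dot v w.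
Proof. by rewrite L2dotDl L2dotNl. Qed.

Lemma L2dotBr u v w : L2dot w (u - v) = L2dot w u - L2dot w v.
Proof. by rewrite L2dotDr L2dotNr. Qed.

Lemma L2dot_norm u : L2dot u u = (L2norm u ^+ 2)%:C%C.
Proof.
rewrite /L2norm sqr_sqrtr; last by apply: Rintegral_ge0 => x _; exact: abs2_ge0.
rewrite /L2dot; under eq_cintegral do rewrite mul_conjc.
by congr Complex => /=; rewrite Rintegral_cst// mul0r.
Qed.

Lemma L2norm_sq_ge0 u : 0 <= complex.Re (L2dot u u).
Proof. by rewrite L2dot_norm/= sqr_ge0. Qed.

Lemma L2norm_ge0 u : 0 <= L2norm u.
Proof. exact: sqrtr_ge0. Qed.

Lemma L2norm_unit u : L2dot u u = 1 -> L2norm u = 1.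
Proof.
rewrite L2dot_norm => -[/eqP].
by rewrite sqrp_eq1 ?L2norm_ge0// => /eqP.
Qed.

Lemma L2norm_eq u v : L2dot u u = L2dot v v -> L2norm u = L2norm v.
Proof.
rewrite !L2dot_norm => -[/eqP].
by rewrite eqrXn2// ?L2norm_ge0// => /eqP.
Qed.

Lemma L2dot_eq0 u : L2dot u u = 0 -> u = 0.
Proof.
move=> /eqP; rewrite L2dot_norm eq_complex/= eqxx andbT.
rewrite /L2norm sqr_sqrtr; last by apply: Rintegral_ge0 => x _; exact: abs2_ge0.
move=> /eqP u0; apply: L2_ext.
have m2 := measurable_abs2 (L2_cmeasurable u).
have : (\int[mu]_x `|(abs2 (repr u x))%:E| = 0)%E.
  under eq_integral do rewrite /= ger0_norm ?abs2_ge0//.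
  rewrite -[LHS]fineK; first by congr EFin.
  rewrite ge0_fin_numE; first exact: L2_lty.
  by apply: integral_ge0 => x _; rewrite lee_fin abs2_ge0.
move=> /(ae_eq_integral_abs mu measurableT m2).
apply: filterS2 repr0 => x -> /(_ Logic.I)/= [] /abs2_eq0 -> //.
Qed.

Lemma L2dot_inj u v : (forall w, L2dot w u = L2dot w v) -> u = v.
Proof.
move=> uv; apply/eqP; rewrite -subr_eq0; apply/eqP; apply: L2dot_eq0.
by rewrite L2dotBr uv subrr.
Qed.

End L2_space.

Section restriction.
Context d (T : measurableType d) (R : realType).
Variable mu : {measure set T -> \bar R}.
Implicit Types (I : set T) (u v : L2 mu) (a : R[i]).

Lemma repr_mult_indic I u : measurable I ->
  {ae mu, forall x, repr (mult_indic I u) x = if x \in I then repr u x else 0}.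
Proof.
move=> mI; apply: repr_L2_of.
apply: (@square_integrable_le _ _ _ _ _ (repr u)).
- by apply: cmeasurable_if => //; exact: L2_cmeasurable.
- exact: L2fun_sqi.
- by move=> x; case: ifP => // _; rewrite /abs2/= expr0n addr0 abs2_ge0.
Qed.

Lemma mult_indicD I u v : measurable I ->
  mult_indic I (u + v) = mult_indic I u + mult_indic I v.
Proof.
move=> mI; apply: L2_ext.
have h1 := repr_mult_indic (u + v) mI; have h2 := repr_mult_indic u mI.
have h3 := repr_mult_indic v mI; have h4 := reprD u v.
have h5 := reprD (mult_indic I u) (mult_indic I v).
near=> x; rewrite (near h1 x)// (near h5 x)// (near h2 x)// (near h3 x)//.
by rewrite (near h4 x)//; case: ifP; rewrite ?addr0.
Unshelve. all: by end_near. Qed.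

Lemma mult_indicZ I a u : measurable I ->
  mult_indic I (a *: u) = a *: mult_indic I u.
Proof.
move=> mI; apply: L2_ext.
have h1 := repr_mult_indic (a *: u) mI; have h2 := repr_mult_indic u mI.
have h3 := reprZ a u; have h4 := reprZ a (mult_indic I u).
near=> x; rewrite (near h1 x)// (near h4 x)// (near h2 x)// (near h3 x)//.
by case: ifP; rewrite ?mulr0.
Unshelve. all: by end_near. Qed.

Lemma mult_indicB I u v : measurable I ->
  mult_indic I (u - v) = mult_indic I u - mult_indic I v.
Proof. by move=> mI; rewrite mult_indicD// -scaleN1r mult_indicZ// scaleN1r. Qed.

Lemma mult_indic_idem I u : measurable I ->
  mult_indic I (mult_indic I u) = mult_indic I u.
Proof.
move=> mI; apply: L2_ext.
have h1 := repr_mult_indic (mult_indic I u) mI; have h2 := repr_mult_indic u mI.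
by near=> x; rewrite (near h1 x)// (near h2 x)//; case: (x \in I).
Unshelve. all: by end_near. Qed.

Lemma mult_indic_adj I u v : measurable I ->
  L2dot (mult_indic I u) v = L2dot u (mult_indic I v).
Proof.
move=> mI.
rewrite (@L2dot_ae _ _ _ _ _ _ (fun x => if x \in I then repr u x else 0) (repr v)).
- rewrite (@L2dot_ae _ _ _ _ u _ (repr u) (fun x => if x \in I then repr v x else 0)).
  + by apply: eq_cintegral => x; case: ifP; rewrite ?mul0r// conjc0 mulr0.
  + exact: L2_cmeasurable.
  + by apply: cmeasurable_if => //; exact: L2_cmeasurable.
  + exact: aeW.
  + exact: repr_mult_indic.
- by apply: cmeasurable_if => //; exact: L2_cmeasurable.
- exact: L2_cmeasurable.
- exact: repr_mult_indic.
- exact: aeW.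
Qed.

(** On a set of finite measure [L^2] is contained in [L^1], because
[t <= 1 + t^2]. *)
Lemma cintegrable_mult_indic I u : measurable I -> (mu I < +oo)%E ->
  cintegrable mu (repr (mult_indic I u)).
Proof.
move=> mI Ioo; apply: ae_cintegrable (repr_mult_indic u mI) _.
  exact: L2_cmeasurable.
apply: (@le_cintegrable _ _ _ _ _ (fun x => \1_I x + 2 * abs2 (repr u x))).
- by apply: cmeasurable_if => //; exact: L2_cmeasurable.
- move=> x; rewrite indicE; have := abs2_ge0 (repr u x).
  have := l1norm_le_abs2 (repr u x); have := l1norm_ge0 (repr u x).
  case: ifP => _ h0 h1 h2; last by rewrite /l1norm/= normr0; lra.
  by have := sqr_ge0 (l1norm (repr u x) - 1); rewrite mulr1n; nra.
have i1 : mu.-integrable setT (EFin \o (\1_I : T -> R)).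
  apply/integrableP; split; first by apply/measurable_EFinP; exact: measurable_indic.
  under eq_integral do rewrite /= ger0_norm//.
  by rewrite integral_indic// setIT.
have i2 : mu.-integrable setT (EFin \o (fun x => abs2 (repr u x))).
  apply/integrableP; split; first exact: measurable_abs2 (L2_cmeasurable u).
  under eq_integral do rewrite /= ger0_norm ?abs2_ge0//.
  exact: L2_lty.
exact: (integrableD measurableT i1 (integrableZl measurableT 2 i2)).
Qed.

(** Take for [v] the restrictions of [u] to sets of finite measure: they are
integrable, and [<v, u>] is the squared norm of [v]. *)
Lemma L2_total (s : sigma_finite setT mu) u :
  (forall v, cintegrable mu (repr v) -> L2dot v u = 0) -> u = 0.
Proof.
move=> u0; have [B TB /all_and2[mB Boo]] := s.
have Bu0 k : mult_indic (B k) u = 0.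
  apply: L2dot_eq0; rewrite -mult_indic_adj// mult_indic_idem//.
  by rewrite u0//; exact: cintegrable_mult_indic.
apply: L2_ext.
have h0 := repr0 mu.
have h : {ae mu, forall x, forall k, x \in B k -> repr u x = 0}.
  apply: ae_foralln => k.
  have := repr_mult_indic u (mB k); rewrite Bu0 => h1.
  by near=> x; have := near h1 x; rewrite (near h0 x)// => /[swap] -> ->.
near=> x; rewrite (near h0 x)//.
have [k _ Bkx] : (\bigcup_k B k) x by rewrite -TB.
have hx : forall k, x \in B k -> repr u x = 0 by near: x.
by apply: (hx k); rewrite inE.
Unshelve. all: by end_near. Qed.

End restriction.

Section bounded_restriction.
Context d (T : measurableType d) (R : realType).
Variable mu : {measure set T -> \bar R}.
Implicit Types (I : set T) (u : L2 mu).

Lemma sqn_mult_indic_bounded I u (M : R) : measurable I -> (mu I < +oo)%E ->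
  0 <= M -> {ae mu, forall x, abs2 (repr u x) <= M} ->
  complex.Re (L2dot (mult_indic I u) (mult_indic I u)) <= M * fine (mu I).
Proof.
move=> mI Ioo M0 uM; rewrite L2dot_norm/= /L2norm sqr_sqrtr; last first.
  by apply: Rintegral_ge0 => x _; exact: abs2_ge0.
rewrite -lee_fin; rewrite /Rintegral fineK; last first.
  rewrite ge0_fin_numE; first exact: L2_lty.
  by apply: integral_ge0 => x _; rewrite lee_fin abs2_ge0.
have mP := measurable_abs2 (L2_cmeasurable (mult_indic I u)).
have m1 : measurable_fun setT (fun x => (M * \1_I x)%:E).
  by apply/measurable_EFinP; apply: measurable_funM => //; exact: measurable_indic.
apply: (@le_trans _ _ (\int[mu]_x (M * \1_I x)%:E)%E).
  apply: ae_ge0_le_integral => //.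
  - by move=> x _; rewrite lee_fin abs2_ge0.
  - by move=> x _; rewrite lee_fin mulr_ge0.
  have h := repr_mult_indic u mI.
  near=> x => _; rewrite lee_fin (near h x)// indicE.
  case: ifP => _; first by rewrite mulr1 (near uM x).
  by rewrite mulr0 /abs2/= expr0n addr0.
under eq_integral do rewrite EFinM.
rewrite ge0_integralZl//.
- by rewrite integral_indic// setIT EFinM fineK// ge0_fin_numE.
- by apply/measurable_EFinP; exact: measurable_indic.
Unshelve. all: by end_near. Qed.

End bounded_restriction.

Section unit_indicator.
Context d (T : measurableType d) (R : realType).
Variable mu : {measure set T -> \bar R}.
Variable A : set T.
Hypotheses (mA : measurable A) (A0 : (0 < mu A)%E) (Aoo : (mu A < +oo)%E).

Let m : R := fine (mu A).

Let m0 : 0 < m.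
Proof. by rewrite fine_gt0// A0. Qed.

Let f (x : T) : R[i] := if x \in A then ((Num.sqrt m)^-1)%:C%C else 0.

Let mf : cmeasurable f.
Proof. by apply: cmeasurable_if => //; exact: cmeasurable_cst. Qed.

Let abs2f x : abs2 (f x) = m^-1 * \1_A x.
Proof.
rewrite /f indicE; case: ifP => _.
  by rewrite /abs2/= expr0n addr0 mulr1 exprVn sqr_sqrtr// ltW.
by rewrite /abs2/= expr0n addr0 mulr0.
Qed.

Let l1f x : l1norm (f x) = (Num.sqrt m)^-1 * \1_A x.
Proof.
rewrite /f indicE; case: ifP => _; rewrite /l1norm/= normr0 addr0.
  by rewrite mulr1 ger0_norm// invr_ge0 sqrtr_ge0.
by rewrite mulr0.
Qed.

Let integrable_1A : mu.-integrable setT (EFin \o (\1_A : T -> R)).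
Proof.
apply/integrableP; split; first by apply/measurable_EFinP; exact: measurable_indic.
under eq_integral do rewrite /= ger0_norm//.
by rewrite integral_indic// setIT.
Qed.

Let Rintegral_1A : \int[mu]_x \1_A x = m.
Proof. by rewrite /Rintegral integral_indic// setIT. Qed.

Definition unit_indic : L2 mu := L2_of mu f.

Lemma repr_unit_indic : {ae mu, forall x, repr unit_indic x = f x}.
Proof.
apply: repr_L2_of; rewrite inE; split => //.
under eq_integral do rewrite abs2f EFinM.
rewrite ge0_integralZl//; last 2 first.
- by apply/measurable_EFinP; exact: measurable_indic.
- by rewrite lee_fin invr_ge0 ltW.
by rewrite integral_indic// setIT lte_mul_pinfty// lee_fin invr_ge0 ltW.
Qed.

Lemma mult_indic_unit_indic I : measurable I -> A `<=` I ->
  mult_indic I unit_indic = unit_indic.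
Proof.
move=> mI AI; apply: L2_ext.
have h := repr_mult_indic unit_indic mI; have h' := repr_unit_indic.
near=> x; rewrite (near h x)// (near h' x)//.
case: ifPn => // xI; rewrite /f ifF//.
by apply/negbTE; apply: contra xI => /set_mem xA; apply/mem_set/AI.
Unshelve. all: by end_near. Qed.

Lemma cintegrable_unit_indic : cintegrable mu (repr unit_indic).
Proof. by rewrite -(@mult_indic_unit_indic A)//; exact: cintegrable_mult_indic. Qed.

Lemma L2dot_unit_indic : L2dot unit_indic unit_indic = 1.
Proof.
rewrite (L2dot_ae mf mf repr_unit_indic repr_unit_indic).
under eq_cintegral do rewrite mul_conjc abs2f.
apply: eq_complexP; last by rewrite /= Rintegral_cst// mul0r.
by rewrite /= RintegralZl// Rintegral_1A mulVf// gt_eqF.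
Qed.

Lemma Rintegral_l1norm_unit_indic :
  \int[mu]_x l1norm (repr unit_indic x) = Num.sqrt m.
Proof.
transitivity (\int[mu]_x l1norm (f x)).
  congr fine; apply: ae_eq_integral => //.
  - by apply/measurable_EFinP/measurable_l1norm/L2_cmeasurable.
  - exact/measurable_EFinP/measurable_l1norm.
  - by apply: filterS repr_unit_indic => x ->.
under eq_Rintegral do rewrite l1f.
rewrite RintegralZl// Rintegral_1A -{2}(sqr_sqrtr (ltW m0)) expr2 mulKf//.
by rewrite gt_eqF// sqrtr_gt0.
Qed.

End unit_indicator.

(** * Unitary operators of order four *)

Section combinations.
Context (K : pzRingType) (V : lmodType K) (x0 x1 x2 x3 : V).

Definition comb4 (a b c e : K) : V := a *: x0 + b *: x1 + c *: x2 + e *: x3.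

Lemma comb4D a b c e a' b' c' e' : comb4 a b c e + comb4 a' b' c' e' =
  comb4 (a + a') (b + b') (c + c') (e + e').
Proof. by rewrite /comb4 !scalerDl addrACA [X in X + _]addrACA [X in X + _ + _]addrACA. Qed.

Lemma comb4Z k a b c e : k *: comb4 a b c e = comb4 (k * a) (k * b) (k * c) (k * e).
Proof. by rewrite /comb4 !scalerDr !scalerA. Qed.

End combinations.

Section unitary_order4.
Context d (T : measurableType d) (R : realType).
Variable mu : {measure set T -> \bar R}.
Variable U : L2 mu -> L2 mu.
Hypotheses (hU : Defs.is_unitary U) (U4 : forall w, U (U (U (U w))) = w).
Implicit Types (u v w : L2 mu) (a : R[i]).

Lemma unitaryD u v : U (u + v) = U u + U v.
Proof. by have [lU _ _] := hU; rewrite -[u]scale1r lU !scale1r. Qed.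

Lemma unitaryZ a u : U (a *: u) = a *: U u.
Proof.
have [lU _ _] := hU.
have U0 : U 0 = 0 by apply: (addrI (U 0)); rewrite -unitaryD !addr0.
by rewrite -[a *: u]addr0 lU U0 addr0.
Qed.

Lemma unitaryB u v : U (u - v) = U u - U v.
Proof. by rewrite unitaryD -scaleN1r unitaryZ scaleN1r. Qed.

Lemma unitary_dot u v : L2dot (U u) (U v) = L2dot u v.
Proof. by have [_ _] := hU. Qed.

Lemma adjoint_order4 v : adjoint U v = U (U (U v)).
Proof.
apply: xget_unique => [u|w hw].
  by rewrite -[in LHS](U4 v) unitary_dot.
by apply: L2dot_inj => u; rewrite -hw -[in LHS](U4 v) unitary_dot.
Qed.

(** The average of [a^-k U^k] over a period projects onto the [a]-eigenspace; the
coefficients are written as [a^(4 - k)]. *)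
Lemma eigenproj_order4 a u : a * conjc a = 1 -> a ^+ 4 = 1 ->
  eigenproj U a u =
  (4^-1)%:C%C *: comb4 u (U u) (U (U u)) (U (U (U u))) 1 (a ^+ 3) (a ^+ 2) a.
Proof.
move=> aa a4.
set w := (X in _ = X).
have Uw : U w = a *: w.
  rewrite /w scalerA mulrC -scalerA unitaryZ; congr (_ *: _).
  rewrite /comb4 !unitaryD !unitaryZ U4 !scalerDr !scalerA mulr1 -!exprS a4.
  by rewrite -expr2 addrC !addrA.
have orth v : U v = a *: v -> L2dot (u - w) v = 0.
  move=> Uv.
  have E x : L2dot (U x) v = a * L2dot x v.
    have vE : v = conjc a *: U v by rewrite Uv scalerA mulrC aa scale1r.
    by rewrite [in LHS]vE L2dotZr unitary_dot conjcK.
  rewrite L2dotBl /w L2dotZl /comb4 !L2dotDl !L2dotZl !E.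
  set t := L2dot u v.
  have -> : 1 * t + a ^+ 3 * (a * t) + a ^+ 2 * (a * (a * t)) +
    a * (a * (a * (a * t))) = (1 + 3 * a ^+ 4) * t by ring.
  have -> : 1 + 3 * a ^+ 4 = (4 : R)%:C%C by rewrite a4 rmorph_nat; ring.
  by rewrite mulrA -rmorphM/= mulVf// mul1r subrr.
apply: xget_unique => [//|w' [Uw' orth']].
apply/eqP; rewrite -subr_eq0; apply/eqP; apply: L2dot_eq0.
have h : U (w' - w) = a *: (w' - w) by rewrite unitaryB Uw' Uw scalerBr.
have -> : L2dot (w' - w) (w' - w) = L2dot (u - w) (w' - w) - L2dot (u - w') (w' - w).
  by rewrite -L2dotBl; congr L2dot; rewrite opprB [RHS]addrC addrA subrK.
by rewrite orth// orth'// subrr.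
Qed.

End unitary_order4.

(** * Lebesgue measure: reflection invariance and small subsets *)

Section outer_measure_involution.
Context d (T : measurableType d) (R : realType).
Variables (mu : {measure set T -> \bar R}) (s : T -> T).
Hypotheses (sK : involutive s) (ms : measurable_fun setT s)
  (mus : forall A, measurable A -> mu (s @^-1` A) = mu A).

(** [s] maps the measurable covers of a set to those of its image, with the same
total measure. *)
Lemma mu_ext_involution X : mu_ext mu (s @^-1` X) = mu_ext mu X.
Proof.
suff le Y : (mu_ext mu (s @^-1` Y) <= mu_ext mu Y)%E.
  apply/eqP; rewrite eq_le le/=.
  by have := le (s @^-1` X); rewrite -comp_preimage (_ : s \o s = id)//; apply/funext.
apply: le_ereal_inf_tmp => _ [A [mA YA] <-].
apply: ereal_inf_lbound; exists (fun k => s @^-1` (A k)).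
  split=> [k|x /YA[k _ Ak]]; last by exists k.
  by rewrite -[X in measurable X]setTI; exact: ms.
by apply: eq_eseriesr => k _; exact: mus.
Qed.

(** The completed sigma-algebra is defined by the outer measure alone, which [s]
preserves. *)
Lemma measurable_cara_involution :
  measurable_fun setT (s : caratheodory_type (mu_ext mu) -> caratheodory_type (mu_ext mu)).
Proof.
move=> _ A mA; rewrite setTI.
suff : caratheodory_measurable (mu_ext mu) (s @^-1` A) by [].
have {}mA : caratheodory_measurable (mu_ext mu) A by [].
move=> X.
rewrite -(mu_ext_involution X) -(mu_ext_involution (X `&` _)).
rewrite -(mu_ext_involution (X `&` ~` _)) mA; congr (mu_ext mu _ + mu_ext mu _)%E.
  by apply/seteqP; split => x /=; rewrite sK.
by apply/seteqP; split => x /=; rewrite sK.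
Qed.

End outer_measure_involution.

Lemma lebesgue_measure_oppr (R : realType) (A : set (measurableTypeR R)) :
  measurable A -> lebesgue_measure (-%R @^-1` A) = lebesgue_measure A.
Proof.
move=> mA.
have mopp : measurable_fun [set: measurableTypeR R] (-%R : _ -> measurableTypeR R).
  exact: oppr_measurable.
pose nu : {measure set (measurableTypeR R) -> \bar R} :=
  measure_function_pushforward__canonical__measure_function_Measure
    (@lebesgue_measure R) mopp.
rewrite -[LHS]/(nu A); apply/esym/lebesgue_measure_unique => // _ [[a b] _ <-]/=.
rewrite /nu/= /pushforward (_ : _ @^-1` _ = `[- b, - a[%classic).
  by rewrite !lebesgue_measure_itv/= !lte_fin ltrN2; case: ifP => // _; rewrite -!EFinB opprK addrC.
by apply/seteqP; split => x /=; rewrite !in_itv/= lerNl ltrNr andbC.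
Qed.

Section reflection.
Context (R : realType).

Definition tuple_opp n (x : n.-tuple (measurableTypeR R)) :
  n.-tuple (measurableTypeR R) := map_tuple -%R x.

Lemma tuple_oppK n : involutive (@tuple_opp n).
Proof. by move=> x; apply: eq_from_tnth => i; rewrite !tnth_map opprK. Qed.

Lemma measurable_tuple_opp n : measurable_fun setT (@tuple_opp n).
Proof.
apply/measurable_fun_tnthP => i.
rewrite (_ : _ \o _ = -%R \o (fun x : n.-tuple (measurableTypeR R) => tnth x i)).
  by apply: measurableT_comp; [exact: oppr_measurable|exact: measurable_tnth].
by apply/funext => x /=; rewrite tnth_map.
Qed.

(** Slice by slice: the section at [x] of the reflected set is the reflection of
the section at [- x]. *)
Lemma borel_lebesgue_opp n (A : set (n.-tuple (measurableTypeR R))) :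
  measurable A -> borel_lebesgue R n (@tuple_opp n @^-1` A) = borel_lebesgue R n A.
Proof.
elim: n A => [|n IH] A mA.
  rewrite /= !diracE; congr (_%:R%:E).
  by congr nat_of_bool; apply/idP/idP; rewrite !inE/= (tuple0 (tuple_opp _)).
have mcons : measurable_fun setT (fun p : (measurableTypeR R * n.-tuple (measurableTypeR R))%type =>
    [the n.+1.-tuple (measurableTypeR R) of p.1 :: p.2]) by exact: measurable_cons.
rewrite /= /cons_measure /pushforward /product_measure1.
set B := [set p : (measurableTypeR R * n.-tuple (measurableTypeR R))%type
   | A [the n.+1.-tuple (measurableTypeR R) of p.1 :: p.2]].
have mB : measurable B by rewrite -[B]setTI; exact: mcons.
transitivity (\int[lebesgue_measure]_(x in setT) ((borel_lebesgue R n \o xsection B) \o -%R) x)%E.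
  apply: eq_integral => x _ /=.
  rewrite -(IH (xsection B (- x))); last exact: measurable_xsection.
  congr (borel_lebesgue R n _); apply/seteqP; split => y /=; rewrite /xsection/= !inE /=.
    rewrite /B/=; congr A; exact/val_inj.
  rewrite /B/=; congr A; exact/val_inj.
have mopp : measurable_fun [set: measurableTypeR R] (-%R : _ -> measurableTypeR R).
  exact: oppr_measurable.
rewrite -[X in (integral _ X _)](preimage_setT (-%R : measurableTypeR R -> measurableTypeR R)).
rewrite -(ge0_integral_pushforward mopp)//; last first.
  exact: measurable_fun_xsection.
apply: (@eq_measure_integral _ _ _ setT lebesgue_measure) => C mC _.
exact: lebesgue_measure_oppr.
Qed.

Definition reflection n : Rn R n -> Rn R n := @tuple_opp n.

Lemma reflectionK n : involutive (@reflection n).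
Proof. exact: tuple_oppK. Qed.

Lemma measurable_reflection n : measurable_fun setT (@reflection n).
Proof.
apply: measurable_cara_involution.
- exact: tuple_oppK.
- exact: measurable_tuple_opp.
- exact: borel_lebesgue_opp.
Qed.

Lemma lebesgue_Rn_reflection n (A : set (Rn R n)) :
  lebesgue_Rn (@reflection n @^-1` A) = lebesgue_Rn A.
Proof.
apply: mu_ext_involution.
- exact: tuple_oppK.
- exact: measurable_tuple_opp.
- exact: borel_lebesgue_opp.
Qed.

Lemma ae_reflection n (P : Rn R n -> Prop) :
  {ae @lebesgue_Rn R n, forall x, P x} ->
  {ae @lebesgue_Rn R n, forall x, P (reflection x)}.
Proof.
apply: ae_preserving; first exact: measurable_reflection.
by move=> A _; exact: lebesgue_Rn_reflection.
Qed.

Lemma ge0_integral_reflection n (f : Rn R n -> \bar R) :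
  measurable_fun setT f -> (forall x, 0 <= f x)%E ->
  (\int[@lebesgue_Rn R n]_x f (reflection x) = \int[@lebesgue_Rn R n]_x f x)%E.
Proof.
apply: ge0_integral_preserving; first exact: measurable_reflection.
by move=> A _; exact: lebesgue_Rn_reflection.
Qed.

Lemma cintegral_reflection n (f : Rn R n -> R[i]) : cmeasurable f ->
  cintegral (@lebesgue_Rn R n) (fun x => f (reflection x)) =
  cintegral (@lebesgue_Rn R n) f.
Proof.
apply: cintegral_preserving; first exact: measurable_reflection.
by move=> A _; exact: lebesgue_Rn_reflection.
Qed.

(** Sigma-finiteness survives completion; it is needed for Fubini's theorem and
for truncating square integrable functions. *)
Lemma lebesgue_Rn_sigma_finite n : sigma_finite setT (@lebesgue_Rn R n).
Proof.
apply: completed_measure_extension_sigma_finite.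
exact: (sigma_finiteT (borel_lebesgue R n)).
Qed.

Lemma borel_measurable_Rn n (A : set (n.-tuple (measurableTypeR R))) :
  measurable A -> measurable (A : set (Rn R n)).
Proof. by move=> mA; apply: sub_caratheodory; apply: sub_sigma_algebra. Qed.

Lemma lebesgue_RnE n (A : set (n.-tuple (measurableTypeR R))) :
  measurable A -> lebesgue_Rn (A : set (Rn R n)) = borel_lebesgue R n A.
Proof. exact: measurable_mu_extE. Qed.

Lemma measurable_Rn_coord n (i : 'I_n) :
  measurable_fun setT (fun x : Rn R n => tnth (x : n.-tuple R) i).
Proof.
move=> _ Y mY; rewrite setTI; apply: borel_measurable_Rn.
rewrite -[X in measurable X]setTI.
exact: (@measurable_tnth _ (measurableTypeR R) n i).
Qed.

(** Slabs [G l] of finite measure in the last coordinates, times short intervals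
in the first one, give a countable cover by sets of measure at most [e]; one of them
meets [I] in a set of positive measure. *)
Lemma small_measurable_subset n (I : set (Rn R n.+1)) (e : R) : 0 < e ->
  measurable I -> (0 < lebesgue_Rn I)%E ->
  exists A, [/\ measurable A, A `<=` I, (0 < lebesgue_Rn A)%E &
    (lebesgue_Rn A <= e%:E)%E].
Proof.
move=> e0 mI I0.
have [G TG /all_and2[mG Goo]] := sigma_finiteT (borel_lebesgue R n).
pose m l : R := fine (borel_lebesgue R n (G l)).
have m_ge0 l : 0 <= m l by rewrite fine_ge0.
have mE l : borel_lebesgue R n (G l) = (m l)%:E.
  by rewrite /m fineK// ge0_fin_numE ?Goo ?measure_ge0.
(* Intervals of length [e / m l] would do, were it not that [m l] may vanish. *)
pose c l := e / (m l + 1).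
have c0 l : 0 < c l by rewrite divr_gt0// ltr_wpDl.
pose J (k : int) l : set (measurableTypeR R) := `[k%:~R * c l, (k + 1)%:~R * c l[%classic.
have mJ k l : measurable (J k l) by exact: measurable_itv.
have JE k l : lebesgue_measure (J k l) = (c l)%:E.
  rewrite /J lebesgue_measure_itv/= lte_fin ltr_pM2r// ltr_int ltrDl ltr01.
  by rewrite -EFinB -mulrBl -intrB [_ + 1]addrC addrK mul1r.
pose B (p : int * nat) : set (Rn R n.+1) :=
  [set t : n.+1.-tuple (measurableTypeR R) | J p.1 p.2 (thead t) /\ G p.2 [tuple of behead t]].
have mB p : measurable (B p : set (n.+1.-tuple (measurableTypeR R))).
  apply: measurableI.
    have := @measurable_tnth _ (measurableTypeR R) n.+1 ord0 measurableT _ (mJ p.1 p.2).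
    by rewrite setTI.
  have := @measurable_behead _ (measurableTypeR R) n measurableT _ (mG p.2).
  by rewrite setTI.
have Be p : (lebesgue_Rn (B p) <= e%:E)%E.
  rewrite lebesgue_RnE// /= /cons_measure /pushforward.
  rewrite (_ : _ @^-1` _ = J p.1 p.2 `*` G p.2); last first.
    apply/seteqP; split => -[x y] /= [Jx Gy]; split => //=.
      rewrite (_ : y = [tuple of behead [tuple of x :: y]])//; exact/val_inj.
    by rewrite (_ : [tuple of behead [tuple of x :: y]] = y)//; exact/val_inj.
  rewrite product_measure1E//.
  have := congr1 (fun x => x * _)%E (JE p.1 p.2) => -> /=.
  rewrite mE -EFinM lee_fin /c mulrAC.
  by rewrite ler_pdivrMr ?ltr_wpDl// ler_pM2l// lerDl.
have TB : I `<=` \bigcup_p (I `&` B p).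
  move=> t It.
  have [l _ Gl] : (\bigcup_l G l) [tuple of behead (t : n.+1.-tuple R)] by rewrite -TG.
  pose k := Num.floor (thead (t : n.+1.-tuple R) / c l).
  exists (k, l) => //; split=> //; split=> //=.
  rewrite /J/= in_itv/= -ler_pdivlMr// -ltr_pdivrMr//.
  exact: floor_itv.
have [p /eqP Ip] : exists p, lebesgue_Rn (I `&` B p) != 0%E.
  apply/not_existsP => IB0; move: I0; apply/negP; rewrite -leNgt.
  have [N [mN N0 IN]] : (@lebesgue_Rn R n.+1).-negligible (\bigcup_p (I `&` B p)).
    rewrite (_ : \bigcup_p _ = \bigcup_i
       (if @unpickle (int * nat)%type i is Some p then I `&` B p else set0)).
      apply: negligible_bigcup => i; case: unpickle => [p|]; last exact: negligible_set0.
      apply/negligibleP; last by move/negP/negPn/eqP: (IB0 p).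
      by apply: measurableI => //; exact: borel_measurable_Rn.
    apply/seteqP; split => [t [p _ Ip]|t [i _]].
      exists (pickle p); [exact: Logic.I|by rewrite pickleK; exact: Ip].
    by case: unpickle => // p Ip; exists p.
  by rewrite -N0 le_measure ?inE//; exact: subset_trans IN.
have mIp : measurable (I `&` B p) by apply: measurableI => //; exact: borel_measurable_Rn.
exists (I `&` B p); split => //.
  by rewrite lt0e measure_ge0 andbT; apply/eqP.
by apply: le_trans (Be p); rewrite le_measure ?inE//; exact: borel_measurable_Rn.
Qed.

End reflection.

(** * The Fourier transform squares to the reflection *)

Section parity.
Context (R : realType) (n : nat).
Local Notation mu := (@lebesgue_Rn R n).
Implicit Types u v w : L2 mu.

Definition parity u : L2 mu := L2_of mu (fun x => repr u (reflection x)).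

Lemma cmeasurable_reflection (f : Rn R n -> R[i]) : cmeasurable f ->
  cmeasurable (fun x => f (reflection x)).
Proof.
by move=> [fR fI]; split; [exact: measurableT_comp fR (@measurable_reflection R n)|
  exact: measurableT_comp fI (@measurable_reflection R n)].
Qed.

Lemma repr_parity u : {ae mu, forall x, repr (parity u) x = repr u (reflection x)}.
Proof.
apply: repr_L2_of; rewrite inE; split.
  exact/cmeasurable_reflection/L2_cmeasurable.
rewrite (ge0_integral_reflection (f := fun x => (abs2 (repr u x))%:E)).
- exact: L2_lty.
- exact: measurable_abs2 (L2_cmeasurable u).
- by move=> x; rewrite lee_fin abs2_ge0.
Qed.

Lemma parityK u : parity (parity u) = u.
Proof.
apply: L2_ext; have h := repr_parity (parity u).
have h' := ae_reflection (repr_parity u).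
by near=> x; rewrite (near h x)// (near h' x)// reflectionK.
Unshelve. all: by end_near. Qed.

Lemma L2dot_parity u v : L2dot (parity u) (parity v) = L2dot u v.
Proof.
rewrite (L2dot_ae _ _ (repr_parity u) (repr_parity v)).
- apply: (cintegral_reflection (f := fun x => repr u x * conjc (repr v x))).
  by apply: cmeasurableM; [|apply: cmeasurable_conjc]; exact: L2_cmeasurable.
- exact/cmeasurable_reflection/L2_cmeasurable.
- exact/cmeasurable_reflection/L2_cmeasurable.
Qed.

End parity.

Section fourier_kernel.
Context (R : realType).

Lemma cexpiN (t : R) : cexpi (- t) = conjc (cexpi t).
Proof. by apply: eq_complexP; rewrite /= ?cosN ?sinN. Qed.

Lemma l1norm_cexpi (t : R) : l1norm (cexpi t) <= 2.
Proof. by rewrite /l1norm/= -[leRHS](_ : 1 + 1 = 2)// lerD ?cos_max ?sin_max. Qed.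

Lemma cmeasurable_cexpi d (T : measurableType d) (g : T -> R) :
  measurable_fun setT g -> cmeasurable (fun x => cexpi (g x)).
Proof.
move=> mg; split => /=; apply: measurableT_comp mg.
- by apply: continuous_measurable_fun; exact: continuous_cos.
- by apply: continuous_measurable_fun; exact: continuous_sin.
Qed.

Variable n : nat.
Local Notation mu := (@lebesgue_Rn R n).

Lemma Rn_dotC (x y : Rn R n) : Rn_dot x y = Rn_dot y x.
Proof. by apply: eq_bigr => i _; rewrite mulrC. Qed.

Lemma Rn_dot_reflection (x y : Rn R n) : Rn_dot x (reflection y) = - Rn_dot x y.
Proof.
rewrite /Rn_dot -sumrN; apply: eq_bigr => i _.
by rewrite tnth_map mulrN.
Qed.

Lemma measurable_Rn_dot :
  measurable_fun setT (fun p : Rn R n * Rn R n => Rn_dot p.1 p.2).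
Proof.
rewrite /Rn_dot; apply: measurable_sum => i; apply: measurable_funM.
  exact: measurableT_comp (measurable_Rn_coord i) measurable_fst.
exact: measurableT_comp (measurable_Rn_coord i) measurable_snd.
Qed.

Lemma cmeasurable_fourier_phase :
  cmeasurable (fun p : Rn R n * Rn R n => cexpi (- (2 * pi * Rn_dot p.1 p.2))).
Proof.
apply: cmeasurable_cexpi; apply: measurableT_comp; first exact: oppr_measurable.
by apply: measurable_funM => //; exact: measurable_Rn_dot.
Qed.

Lemma cmeasurable_phase_fst (xi : Rn R n) :
  cmeasurable (fun x : Rn R n => cexpi (- (2 * pi * Rn_dot x xi))).
Proof.
by have [mR mI] := cmeasurable_fourier_phase; split;
  [exact: measurableT_comp mR (measurable_pair2 xi)|
   exact: measurableT_comp mI (measurable_pair2 xi)].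
Qed.

Lemma cintegrable_phase (f : Rn R n -> R[i]) (xi : Rn R n) : cintegrable mu f ->
  cintegrable mu (fun x => f x * cexpi (- (2 * pi * Rn_dot x xi))).
Proof.
move=> If; apply: (@le_cintegrable _ _ _ _ _ (fun x => 2 * l1norm (f x))).
- apply: cmeasurableM; first exact: cintegrable_cmeasurable If.
  exact: cmeasurable_phase_fst.
- move=> x; rewrite (le_trans (l1normM _ _))// mulrC ler_wpM2r ?l1norm_ge0//.
  exact: l1norm_cexpi.
- exact: (integrableZl measurableT 2 (cintegrable_l1norm If)).
Qed.

Lemma l1norm_fourier_integral_le (f : Rn R n -> R[i]) (xi : Rn R n) :
  cintegrable mu f ->
  l1norm (fourier_integral f xi) <= 2 * \int[mu]_x l1norm (f x).
Proof.
move=> If; rewrite (le_trans (l1norm_cintegral_le (cintegrable_phase xi If)))//.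
rewrite -RintegralZl//; last exact: cintegrable_l1norm.
apply: le_Rintegral => //.
- exact: cintegrable_l1norm (cintegrable_phase xi If).
- exact: (integrableZl measurableT 2 (cintegrable_l1norm If)).
- move=> x _; rewrite (le_trans (l1normM _ _))// mulrC ler_wpM2r ?l1norm_ge0//.
  exact: l1norm_cexpi.
Qed.

End fourier_kernel.

Section fourier_plancherel.
Context (R : realType) (n : nat).
Local Notation mu := (@lebesgue_Rn R n).
Variable U : L2 mu -> L2 mu.
Hypothesis hU : is_fourier_plancherel U.
Implicit Types u v w : L2 mu.

(** Both sides are iterated integrals of the kernel
[K (x, y) = u(x) (conjugate of v(y)) e^(-2 pi i x . y)]; on the right, the
conjugate of [v^(- x)] is the integral over [y]. *)
Lemma fourier_dot u v : cintegrable mu (repr u) -> cintegrable mu (repr v) ->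
  L2dot (U u) v = L2dot u (parity (U v)).
Proof.
move=> Iu Iv; have [_ hF] := hU.
pose e (x y : Rn R n) := cexpi (- (2 * pi * Rn_dot x y)).
pose K (p : Rn R n * Rn R n) := repr u p.1 * conjc (repr v p.2) * e p.1 p.2.
have mK : cmeasurable K.
  apply: cmeasurableM; last exact: cmeasurable_fourier_phase.
  apply: cmeasurableM.
    have [mR mI] := L2_cmeasurable u.
    by split; [exact: measurableT_comp mR measurable_fst|
               exact: measurableT_comp mI measurable_fst].
  apply: cmeasurable_conjc; have [mR mI] := L2_cmeasurable v.
  by split; [exact: measurableT_comp mR measurable_snd|
             exact: measurableT_comp mI measurable_snd].
have Kle x y : l1norm (K (x, y)) <= (2 * l1norm (repr u x)) * l1norm (repr v y).
  rewrite (le_trans (l1normM _ _))// [leRHS]mulrC mulrCA [leRHS]mulrC.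
  rewrite ler_pM ?l1norm_ge0 ?l1norm_cexpi//.
  by rewrite (le_trans (l1normM _ _))// l1norm_conjc mulrC.
have If : mu.-integrable setT (EFin \o (fun x => 2 * l1norm (repr u x))).
  exact: (integrableZl measurableT 2 (cintegrable_l1norm Iu)).
have Ig := cintegrable_l1norm Iv.
have s := @lebesgue_Rn_sigma_finite R n.
transitivity (cintegral mu (fun y => cintegral mu (fun x => K (x, y)))).
  apply: ae_eq_cintegral.
  - by apply: cmeasurableM; [|apply: cmeasurable_conjc]; exact: L2_cmeasurable.
  - exact: (cmeasurable_cintegral_fst s s mK Kle If Ig).
  apply: filterS (hF u Iu) => y ->.
  rewrite mulrC -cintegralZ; last exact: cintegrable_phase.
  by apply: eq_cintegral => x; rewrite /K/= -/(e x y) mulrA [conjc _ * _]mulrC.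
rewrite (cintegral_fubini s s mK Kle If Ig); apply: ae_eq_cintegral.
- exact: (cmeasurable_cintegral_snd s s mK Kle If Ig).
- by apply: cmeasurableM; [|apply: cmeasurable_conjc]; exact: L2_cmeasurable.
have h1 := repr_parity (U v); have h2 := ae_reflection (hF v Iv).
near=> x; rewrite (near h1 x)// (near h2 x)//.
rewrite -cintegral_conjc; last exact: cintegrable_phase.
rewrite -cintegralZ.
  apply: eq_cintegral => y; rewrite /K/= /e Rn_dot_reflection conjcM mulrN opprK.
  by rewrite -mulrA -cexpiN Rn_dotC.
have [cR cI] := cintegrable_phase (reflection x) Iv.
split; first by under eq_fun do rewrite Re_conjc.
by under eq_fun do rewrite Im_conjc EFinN; exact: integrableN.
Unshelve. all: by end_near. Qed.

(** On integrable functions [v] the previous lemma says that [R U v] is the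
preimage of [v] under [U].  For a general [w], both [w] and its image under the
isometry [U R U] have the same inner products with all such [v], since these are
fixed by [U R U]. *)
Lemma fourier_parity_fourier w : U (parity (U w)) = w.
Proof.
have [[_ surj iso] _] := hU.
have D v : cintegrable mu (repr v) -> U (parity (U v)) = v.
  move=> Iv; have [z Uz] := surj v.
  suff : z - parity (U v) = 0 by move/eqP; rewrite subr_eq0 => /eqP <-.
  apply: (L2_total (@lebesgue_Rn_sigma_finite R n)) => u Iu.
  by rewrite L2dotBr -fourier_dot// -Uz iso subrr.
apply/eqP; rewrite -subr_eq0; apply/eqP.
apply: (L2_total (@lebesgue_Rn_sigma_finite R n)) => v Iv.
by rewrite L2dotBr -{1}(D _ Iv) iso L2dot_parity iso subrr.
Qed.

Lemma fourier_sq w : U (U w) = parity w.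
Proof.
have inj u v : U u = U v -> u = v.
  move=> Uuv; rewrite -(fourier_parity_fourier u) Uuv.
  exact: fourier_parity_fourier.
by rewrite -[LHS]parityK; congr parity; apply: inj; exact: fourier_parity_fourier.
Qed.

Lemma fourier_pow4 w : U (U (U (U w))) = w.
Proof. by rewrite !fourier_sq parityK. Qed.

End fourier_plancherel.

(** * Commutators of the logarithm of the Fourier transform *)

Section fourier_logarithm.
Context (R : realType) (n : nat).
Local Notation mu := (@lebesgue_Rn R n).
Variable U : L2 mu -> L2 mu.
Hypothesis hU : is_fourier_plancherel U.
Implicit Types (u v : L2 mu) (I : set (Rn R n)).

Let unitU : Defs.is_unitary U. Proof. exact: hU.1. Qed.
Let U4 := fourier_pow4 hU.
Let UD := unitaryD unitU.
Let UZ := unitaryZ unitU.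
Let Udot := unitary_dot unitU.

(** Interpolation of the logarithm at the fourth roots of unity. *)
Lemma fourier_logE u : fourier_log U u =
  (pi / 4)%:C%C *: (Complex 1 (-1) *: U u + Complex 1 1 *: U (U (U u)) - U (U u) - u).
Proof.
have -> : fourier_log U u = (- pi)%:C%C *: eigenproj U (-1) u +
    (pi / 2)%:C%C *: eigenproj U 'i%C u - (pi / 2)%:C%C *: eigenproj U (- 'i%C) u.
  by [].
have i2 : 'i%C ^+ 2 = -1 :> R[i] by exact: sqr_i.
have i3 : 'i%C ^+ 3 = - 'i%C :> R[i] by rewrite exprS i2 mulrN1.
have i4 : 'i%C ^+ 4 = 1 :> R[i] by rewrite (exprM _ 2 2) i2 sqrrN expr1n.
have ii : 'i%C * conjc 'i%C = 1 :> R[i].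
  by apply: eq_complexP; rewrite /=; ring.
have -> : Complex 1 (-1) *: U u + Complex 1 1 *: U (U (U u)) - U (U u) - u =
    comb4 u (U u) (U (U u)) (U (U (U u))) (-1) (Complex 1 (-1)) (-1) (Complex 1 1).
  by rewrite /comb4 !scaleN1r [RHS]addrAC -(addrA (- u)) (addrC (- u)) [RHS]addrAC.
rewrite (eigenproj_order4 unitU U4 u (a := -1)); last 2 first.
- by rewrite conjcN conjc1 mulrNN mulr1.
- by rewrite (exprM _ 2 2) sqrrN !expr1n.
rewrite (eigenproj_order4 unitU U4 u ii i4).
rewrite (eigenproj_order4 unitU U4 u (a := - 'i%C)); last 2 first.
- by rewrite conjcN mulrNN.
- by rewrite (exprM _ 2 2) sqrrN i2 sqrrN expr1n.
have n2 : (-1) ^+ 2 = 1 :> R[i] by rewrite sqrrN expr1n.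
have n3 : (-1) ^+ 3 = -1 :> R[i] by rewrite exprS n2 mulr1.
have j2 : (- 'i%C) ^+ 2 = -1 :> R[i] by rewrite sqrrN.
have j3 : (- 'i%C) ^+ 3 = 'i%C :> R[i] by rewrite exprS j2 mulrN1 opprK.
rewrite n2 n3 i2 i3 j2 j3 -(scaleN1r ((pi / 2)%:C%C *: _)) !comb4Z !comb4D; congr comb4.
all: move: (@pi R) => p; apply: eq_complexP; rewrite !(cReD, cImD, cReM, cImM, cReN, cImN)/=; lra.
Qed.

Lemma fourier_log_unitary u : fourier_log U (U u) = U (fourier_log U u).
Proof. by rewrite !fourier_logE UZ !(unitaryB unitU) UD !UZ. Qed.

Lemma fourier_log_adjoint u : fourier_log U (adjoint U u) = adjoint U (fourier_log U u).
Proof. by rewrite !(adjoint_order4 unitU U4) !fourier_log_unitary. Qed.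

(** [Q] is the conjugate of [P] by [U], with which the logarithm commutes. *)
Lemma commutator_projQ I u :
  commutator (fourier_log U) (projQ U I) u =
  adjoint U (commutator (fourier_log U) (projP I) (U u)).
Proof.
rewrite -[LHS]/(fourier_log U (adjoint U (projP I (U u))) -
  adjoint U (projP I (U (fourier_log U u)))).
rewrite fourier_log_adjoint -fourier_log_unitary.
by rewrite !(adjoint_order4 unitU U4) -!(unitaryB unitU).
Qed.

Lemma L2norm_unitary u : L2norm (U u) = L2norm u.
Proof. exact/L2norm_eq/Udot. Qed.

Lemma opnorm_commutator_projQ I :
  opnorm (commutator (fourier_log U) (projP I)) =
  opnorm (commutator (fourier_log U) (projQ U I)).
Proof.
have norm u : L2norm (commutator (fourier_log U) (projQ U I) u) =
    L2norm (commutator (fourier_log U) (projP I) (U u)).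
  by rewrite commutator_projQ (adjoint_order4 unitU U4) !L2norm_unitary.
congr ereal_sup; apply/seteqP; split=> _ [u /= u1 <-].
  have [_ surj _] := unitU; have [v Uv] := surj u.
  exists v; first by rewrite /= -L2norm_unitary Uv.
  by rewrite norm Uv.
exists (U u); first by rewrite /= L2norm_unitary.
exact: (congr1 EFin (esym (norm u))).
Qed.

(** The summand [-1] of the polynomial in [fourier_logE] does not contribute: it
maps [e] into the range of [P]. *)
Lemma commutator_projP_test I e w : measurable I -> mult_indic I e = e ->
  w = Complex 1 (-1) *: U e + Complex 1 1 *: U (U (U e)) - U (U e) ->
  commutator (fourier_log U) (projP I) e = (pi / 4)%:C%C *: (w - mult_indic I w).
Proof.
move=> mI Pe wE.
rewrite -[LHS]/(fourier_log U (mult_indic I e) - mult_indic I (fourier_log U e)).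
rewrite Pe fourier_logE -wE mult_indicZ// -scalerBr; congr (_ *: _).
by rewrite mult_indicB// Pe opprB addrA subrK.
Qed.

Lemma L2norm_commutator_ge I (t : R) e : measurable I -> 0 < t ->
  mult_indic I e = e -> L2dot e e = 1 ->
  complex.Re (L2dot (mult_indic I (U e)) (mult_indic I (U e))) <= t ^+ 2 ->
  complex.Re (L2dot (mult_indic I (U (U (U e)))) (mult_indic I (U (U (U e)))))
    <= t ^+ 2 ->
  (pi / 4) ^+ 2 * (4 - 18 * t - 8 * t ^+ 2) <=
    L2norm (commutator (fourier_log U) (projP I) e) ^+ 2.
Proof.
move=> mI t0 Pe ee U1 U3.
pose w := Complex 1 (-1) *: U e + Complex 1 1 *: U (U (U e)) - U (U e).
rewrite (commutator_projP_test mI Pe (erefl w)).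
have -> v : L2norm v ^+ 2 = complex.Re (L2dot v v) by rewrite L2dot_norm.
rewrite (sqnZ (@L2dotZl _ _ _ mu) (@L2dotC _ _ _ mu)) /abs2/= expr0n addr0.
rewrite ler_pM2l ?exprn_gt0 ?divr_gt0 ?pi_gt0//.
exact: (sqn_compl_test_ge (@L2dotDl _ _ _ mu) (@L2dotZl _ _ _ mu)
  (@L2dotC _ _ _ mu) (@L2norm_sq_ge0 _ _ _ mu)
  (fun u v => mult_indicD u v mI) (fun a u => mult_indicZ a u mI)
  (fun u => mult_indic_idem u mI) (fun u v => mult_indic_adj u v mI)
  UD UZ Udot U4 t0 Pe ee U1 U3 (erefl w)).
Qed.

End fourier_logarithm.

Section test_vector.
Context (R : realType) (n : nat).
Local Notation mu := (@lebesgue_Rn R n).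
Implicit Types (u : L2 mu) (I A : set (Rn R n)).

(** The normalized indicator function of a set [A] satisfies
[|U e| <= 2 |A|^(1/2)] pointwise, hence the choice [4 |A| |I| <= t^2]; the
reflection carries the bound over to [U^3 e]. *)
Lemma test_vector (U : L2 mu -> L2 mu) I (t : R) : (0 < n)%N ->
  is_fourier_plancherel U -> measurable I ->
  (0 < mu I)%E -> (mu I < +oo)%E -> 0 < t ->
  exists e : L2 mu, [/\ mult_indic I e = e, L2dot e e = 1,
    complex.Re (L2dot (mult_indic I (U e)) (mult_indic I (U e))) <= t ^+ 2 &
    complex.Re (L2dot (mult_indic I (U (U (U e)))) (mult_indic I (U (U (U e)))))
      <= t ^+ 2].
Proof.
move=> n0 hU mI I0 Ioo t0.
have M0 : 0 < fine (mu I) by rewrite fine_gt0// I0.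
have [A [mA AI A0 Ale]] : exists A, [/\ measurable A, A `<=` I, (0 < mu A)%E &
    (mu A <= (t ^+ 2 / (4 * fine (mu I)))%:E)%E].
  have e0 : 0 < t ^+ 2 / (4 * fine (mu I)) by rewrite divr_gt0 ?exprn_gt0 ?mulr_gt0.
  move: e0; move: (t ^+ 2 / _) => r r0; move: mI I0 {Ioo M0}; move: I.
  case: (n) n0 => // k _ I mI I0.
  exact: small_measurable_subset.
have Aoo : (mu A < +oo)%E by rewrite (le_lt_trans Ale)// ltry.
have mle : 4 * fine (mu A) * fine (mu I) <= t ^+ 2.
  move: Ale; rewrite -[mu A]fineK ?ge0_fin_numE// lee_fin ler_pdivlMr ?mulr_gt0//.
  by rewrite mulrA [_ * 4]mulrC.
have m_ge0 : 0 <= 4 * fine (mu A) by rewrite mulr_ge0// fine_ge0.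
set e := unit_indic mu A; have Ie := cintegrable_unit_indic mA A0 Aoo.
have bound : {ae mu, forall x, abs2 (repr (U e) x) <= 4 * fine (mu A)}.
  apply: filterS (hU.2 e Ie) => x ->.
  rewrite (le_trans (abs2_le_l1norm _))//.
  have -> : 4 * fine (mu A) = (2 * \int[mu]_x l1norm (repr e x)) ^+ 2.
    by rewrite Rintegral_l1norm_unit_indic// exprMn sqr_sqrtr ?fine_ge0// -natrX.
  by rewrite ler_pXn2r ?nnegrE ?l1norm_ge0 ?mulr_ge0 ?Rintegral_ge0//
    ?l1norm_fourier_integral_le// => y _; exact: l1norm_ge0.
exists e; split.
- exact: mult_indic_unit_indic.
- exact: L2dot_unit_indic.
- exact: le_trans (sqn_mult_indic_bounded mI Ioo m_ge0 bound) mle.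
rewrite (fourier_sq hU (U e)).
apply: le_trans (sqn_mult_indic_bounded mI Ioo m_ge0 _) mle.
by apply: filterS2 (repr_parity (U e)) (ae_reflection bound) => x ->.
Qed.

End test_vector.

(** The error terms of the lower bound, of order [t], vanish in the limit
[t -> 0]. *)
Lemma le_of_defect (R : realFieldType) (c r : R) : 0 < c -> 0 <= r ->
  (forall t, 0 < t -> c ^+ 2 * (4 - 18 * t - 8 * t ^+ 2) <= r ^+ 2) ->
  2 * c <= r.
Proof.
move=> c0 r0 h; rewrite leNgt; apply/negP => rc.
have k0 : 0 < c ^+ 2 by rewrite exprn_gt0.
have D0 : 0 < 4 * c ^+ 2 - r ^+ 2.
  rewrite subr_gt0 (_ : 4 * c ^+ 2 = (2 * c) ^+ 2); last by ring.
  by rewrite ltr_pXn2r// nnegrE// ltW// mulr_gt0.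
(* For [t <= 1] the error is at most [26 c^2 t]; this [t] makes it at most half of
   the gap [4 c^2 - r^2]. *)
pose t := Num.min 1 ((4 * c ^+ 2 - r ^+ 2) / (52 * c ^+ 2)).
have t0 : 0 < t by rewrite lt_min ltr01 divr_gt0// mulr_gt0.
have t1 : t <= 1 by rewrite ge_min lexx.
have tD : t * (52 * c ^+ 2) <= 4 * c ^+ 2 - r ^+ 2.
  by rewrite -ler_pdivlMr ?mulr_gt0// ge_min lexx orbT.
have t2 : t ^+ 2 <= t by rewrite expr2 ger_pMr.
have := h t t0; move: tD D0 k0; clearbody t.
move: (c ^+ 2) (r ^+ 2) (t ^+ 2) t2 => k q s t2 tD D0 k0 {}h.
have : k * (4 - 26 * t) <= k * (4 - 18 * t - 8 * s) by rewrite ler_pM2l//; lra.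
by rewrite mulrBr; lra.
Qed.

Theorem theorem3p6 (R : realType) (n : nat) (hn : (0 < n)%N)
  (U : L2 (@lebesgue_Rn R n) -> L2 (@lebesgue_Rn R n))
  (hU : is_fourier_plancherel U)
  (I : set (Rn R n)) (mI : measurable I)
  (fI : (lebesgue_Rn I < +oo)%E) :
  opnorm (commutator (fourier_log U) (projP I)) =
    opnorm (commutator (fourier_log U) (projQ U I)) /\
  ((0 < lebesgue_Rn I)%E ->
    ((pi / 2)%:E <= opnorm (commutator (fourier_log U) (projP I)))%E).
Proof.
split; first exact: opnorm_commutator_projQ.
move=> I0; set N := opnorm _.
have le_N e : L2dot e e = 1 ->
    ((L2norm (commutator (fourier_log U) (projP I) e))%:E <= N)%E.
  by move=> ee; apply: ereal_sup_ubound; exists e; rewrite //= L2norm_unit.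
have N0 : (0 <= N)%E.
  have [e [_ ee _ _]] := test_vector hn hU mI I0 fI ltr01.
  by apply: le_trans (le_N _ ee); rewrite lee_fin L2norm_ge0.
have [->|Noo] := eqVneq N +oo%E; first exact: leey.
have NE : N = (fine N)%:E by rewrite fineK// ge0_fin_numE// ltey.
have r0 : 0 <= fine N by rewrite fine_ge0.
rewrite NE lee_fin (_ : pi / 2 = 2 * (pi / 4)); last by field.
apply: le_of_defect => [| |t t0]; [by rewrite divr_gt0 ?pi_gt0|exact: r0|].
have [e [Pe ee U1 U3]] := test_vector hn hU mI I0 fI t0.
apply: le_trans (L2norm_commutator_ge hU mI t0 Pe ee U1 U3) _.
by rewrite ler_pXn2r ?nnegrE ?L2norm_ge0// -lee_fin -NE; exact: le_N.
Qed.
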